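(* Let $G$ be a finite nilpotent group of odd order (written additively, not necessarily commutative), and let $p$ be the smallest prime dividing $|G|$. If $|G|/p$ is a composite number, then $cr(G)=|G|/p+p-2$.
   Context: For a subset $S=\{a_1,\dots,a_k\}$ of a finite additively written group $G$, $\sum(S)$ denotes the set of all elements $a_{i_1}+\cdots+a_{i_l}$ with $1\le l\le k$ and $i_1,\dots,i_l$ pairwise distinct indices (in any order). A subset $S\subseteq G\setminus\{0\}$ is an additive basis of $G$ if $\sum(S)=G$. The critical number $cr(G)$ is the smallest integer $t$ such that every subset $S\subseteq G\setminus\{0\}$ with $|S|\ge t$ satisfies $\sum(S)=G$. *)

(* Defs.v *)
From mathcomp Require Import all_boot all_fingroup all_solvable.
Set Implicit Arguments. Unset Strict Implicit. Unset Printing Implicit Defensive.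
Import GroupScope.

(* The group is written multiplicatively in MathComp: the paper's additive
   "0" is the identity 1, and "a + b" is the (possibly noncommutative)
   product a * b. *)

(* Sigma(S): all products of l >= 1 pairwise distinct elements of S, taken
   in any order.  Choosing l distinct indices of the set S = choosing a
   nonempty subset A of S; "any order" = any permutation of enum A. *)
Definition subset_sums (gT : finGroupType) (S : {set gT}) : {set gT} :=
  [set x | [exists A : {set gT},
     [&& A \subset S, A != set0 &
         has (fun s : seq gT => \prod_(a <- s) a == x) (permutations (enum A))]]].

Definition cr_prop (gT : finGroupType) (G : {group gT}) (t : nat) : bool :=
  [forall S : {set gT}, (S \subset G :\ 1) ==> (t <= #|S|) ==> (subset_sums S == G)].

Lemma cr_prop_exists (gT : finGroupType) (G : {group gT}) : exists t, cr_prop G t.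
Proof.
exists #|G|; apply/forallP => S; apply/implyP => sS; apply/implyP => ht.
have h1 := subset_leq_card sS.
have h2 : #|G :\ 1| < #|G| by rewrite [X in _ < X](cardsD1 1 G) group1.
by move: (leq_ltn_trans (leq_trans ht h1) h2); rewrite ltnn.
Qed.

Definition cr (gT : finGroupType) (G : {group gT}) : nat :=
  ex_minn (cr_prop_exists G).

(* Main.v *)
Require Import Defs.
From mathcomp Require Import all_boot all_fingroup all_solvable.
From mathcomp Require Import zify.

(* Write n = |G| and Sigma0(S) for the products of distinct elements of S, the
   empty product included.  For the lower bound, take a normal subgroup H of
   index p and add p - 2 elements of one coset x H to H minus the identity.

   For the upper bound, if a maximal subgroup M contains more than half of |M|
   elements of S, these already produce M, and the elements of S outside M reach
   every coset of M.  Otherwise fix a central subgroup Z of prime order q.  As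
   |S| is large compared with |G : Z|, choosing one element of S in each of a
   few Z-cosets gives, by Cauchy-Davenport in Z, a full coset of Z; this
   consumes a set S1 with q - 1 + j elements, j < q.  It remains to reach every
   coset of Z with T = S minus S1.  Adding the elements of T one at a time, the
   number of cosets reached grows until the remaining elements generate a
   subgroup that stabilises the set reached; if this happens early, then a proper
   subgroup K contains at least |K : Z| - 1 elements of T, which fill K, and one
   continues with the cosets of K: a new obstruction puts most of S in a maximal
   subgroup.
   If q > p, T has at least |G : Z| - 1 elements, as the argument requires.  If G
   is a p-group, T may be short by j elements; the deficit is made up by j steps
   that gain two cosets instead of one, obtained by averaging over the translates
   of the set reached.  Only |G| = 27, j = 2 escapes this and is done by hand. *)

Set Implicit Arguments.
Unset Strict Implicit.
Unset Printing Implicit Defensive.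

(** * Products of distinct elements *)

(* Cardinals of the same set may carry different, convertible finType
   instances, which lia would treat as distinct atoms. *)
Ltac gen_card :=
  repeat match goal with
  | H : is_true (leq _ _) |- _ => revert H
  | H : @eq nat _ _ |- _ => revert H
  end;
  repeat match goal with H : is_true _ |- _ => clear H end;
  repeat match goal with
  | |- context [@card.body ?T ?A] =>
    let c := fresh "c" in set c := (@card.body T A); clearbody c
  | |- context [@indexg ?T ?A ?B] =>
    let c := fresh "c" in set c := (@indexg T A B); clearbody c
  end.
Ltac clia := intros; gen_card; lia.
Ltac cnia := intros; gen_card; nia.

Section Sums.
Import GroupScope.
Variable gT : finGroupType.
Implicit Types (A B C D S T U W X Y : {set gT}) (G H K L M N Z : {group gT}) (x y g : gT).

Lemma subset_sumsP S x :
  reflect (exists s, [/\ uniq s, {subset s <= S}, s != [::]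
                       & x = \prod_(a <- s) a])
          (x \in subset_sums S).
Proof.
rewrite inE; apply: (iffP existsP) => [[A /and3P[/subsetP sAS nzA /hasP[s]]]|].
  rewrite mem_permutations => eqs /eqP <-; exists s; split=> //.
  - by rewrite (perm_uniq eqs) enum_uniq.
  - by move=> a; rewrite (perm_mem eqs) mem_enum => /sAS.
  apply: contra nzA => /eqP s0; move: eqs; rewrite s0 perm_sym => /perm_nilP e0.
  by rewrite -cards_eq0 cardE e0.
case=> s [us sS nzs ->]; exists [set a in s]; apply/and3P; split.
- by apply/subsetP=> a; rewrite inE => /sS.
- case: s {us sS} nzs => // a s _; apply/set0Pn; exists a.
  by rewrite inE mem_head.
apply/hasP; exists s => //; rewrite mem_permutations.
by apply: uniq_perm => //; [exact: enum_uniq | move=> a; rewrite mem_enum inE].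
Qed.

Definition subset_sums0 S := 1 |: subset_sums S.

Lemma subset_sums0P S x :
  reflect (exists s, [/\ uniq s, {subset s <= S} & x = \prod_(a <- s) a])
          (x \in subset_sums0 S).
Proof.
rewrite in_setU1.
apply: (iffP orP) => [[/eqP-> | /subset_sumsP[s [us sS _ ->]]] | [s [us sS ->]]].
- by exists [::]; split; rewrite ?big_nil.
- by exists s.
case: (eqVneq s [::]) => [-> | nzs]; first by left; rewrite big_nil.
by right; apply/subset_sumsP; exists s.
Qed.

Lemma sums0_1 S : 1 \in subset_sums0 S.
Proof. exact: setU11. Qed.

Lemma sums_sub0 S : subset_sums S \subset subset_sums0 S.
Proof. exact: subsetUr. Qed.

Lemma sums_mono S T : S \subset T -> subset_sums S \subset subset_sums T.
Proof.
move=> /subsetP sST; apply/subsetP=> x /subset_sumsP[s [us sS nzs ->]].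
by apply/subset_sumsP; exists s; split=> // a /sS/sST.
Qed.

Lemma sums0_mono S T : S \subset T -> subset_sums0 S \subset subset_sums0 T.
Proof. by move=> sST; apply: setUS; apply: sums_mono. Qed.

Lemma sub_sums S : S \subset subset_sums S.
Proof.
apply/subsetP=> x Sx; apply/subset_sumsP; exists [:: x].
by split; rewrite ?big_seq1 // => a; rewrite inE => /eqP->.
Qed.

Lemma sub_sums0 S : S \subset subset_sums0 S.
Proof. exact: subset_trans (sub_sums S) (sums_sub0 S). Qed.

Lemma sums0_sub_group S H : S \subset H -> subset_sums0 S \subset H.
Proof.
move=> /subsetP sSH; apply/subsetP=> x /subset_sums0P[s [_ sS ->]].
by rewrite big_seq; apply: group_prod => a /sS/sSH.
Qed.

Lemma sums_sub_group S H : S \subset H -> subset_sums S \subset H.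
Proof. by move=> sSH; apply: subset_trans (sums_sub0 S) (sums0_sub_group sSH). Qed.

Lemma cat_sums A B (s t : seq gT) :
    [disjoint A & B] -> uniq s -> {subset s <= A} -> uniq t -> {subset t <= B} ->
  uniq (s ++ t) /\ {subset s ++ t <= A :|: B}.
Proof.
move=> dAB us sA ut tB; split; last first.
  by move=> a; rewrite mem_cat inE => /orP[/sA-> | /tB->]; rewrite ?orbT.
rewrite cat_uniq us ut andbT; apply/hasPn=> a /tB aB; apply/negP=> /sA aA.
by move/pred0P/(_ a): dAB; rewrite /= aA aB.
Qed.

Lemma sums0M A B : [disjoint A & B] ->
  subset_sums0 A * subset_sums0 B \subset subset_sums0 (A :|: B).
Proof.
move=> dAB; apply/subsetP=> z /mulsgP[x y /subset_sums0P[s [us sA ->]]].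
move=> /subset_sums0P[t [ut tB ->]] ->; rewrite -big_cat.
have [ust sst] := cat_sums dAB us sA ut tB.
by apply/subset_sums0P; exists (s ++ t).
Qed.

Lemma sums0M_sums A B : [disjoint A & B] ->
  subset_sums0 A * subset_sums B \subset subset_sums (A :|: B).
Proof.
move=> dAB; apply/subsetP=> z /mulsgP[x y /subset_sums0P[s [us sA ->]]].
move=> /subset_sumsP[t [ut tB nzt ->]] ->; rewrite -big_cat.
have [ust sst] := cat_sums dAB us sA ut tB.
apply/subset_sumsP; exists (s ++ t); split=> //.
by rewrite -size_eq0 size_cat addn_eq0 negb_and (size_eq0 t) nzt orbT.
Qed.

(** Normality turns [subset_sums0 T * (g *: Z)] into [subset_sums0 T * Z :* g], which is all of [G].
    The factor taken from [S1] is a nonempty product, so the identity is also reached by a nonempty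
    one. *)
Lemma sums_of_coset S S1 T Z G g :
    Z <| G -> S \subset G -> S1 \subset S -> T \subset S -> [disjoint T & S1] ->
    g *: Z \subset subset_sums S1 -> subset_sums0 T * Z = G ->
  subset_sums S = G.
Proof.
move=> nZG sSG sS1S sTS dTS1 sgZ eqG; apply/eqP; rewrite eqEsubset.
rewrite sums_sub_group //=.
have Gg: g \in G.
  apply: (subsetP (sums_sub_group (subset_trans sS1S sSG))).
  by apply: (subsetP sgZ); rewrite lcoset_refl.
have <-: subset_sums0 T * (g *: Z) = G.
  rewrite -norm_rlcoset ?(subsetP (normal_norm nZG)) // mulgA eqG.
  exact: rcoset_id.
apply: subset_trans (mulgS _ sgZ) _.
apply: subset_trans (sums0M_sums dTS1) _; apply: sums_mono.
by rewrite subUset sTS.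
Qed.

End Sums.

(** * Growth of sets of partial products *)

Section Growth.
Import GroupScope.
Variable gT : finGroupType.
Implicit Types (A B C D S T U W X Y : {set gT}) (G H K L M N Z : {group gT}) (x y g : gT).

Definition lstab W := [set x | x *: W == W].

Lemma lstab_group_set W : group_set (lstab W).
Proof.
apply/group_setP; split=> [|x y]; rewrite !inE ?mul1g // => /eqP xW /eqP yW.
by rewrite lcosetM yW xW.
Qed.
Canonical lstab_group W := Group (lstab_group_set W).

Lemma lstab_mul W L : L \subset lstab W -> L * W = W.
Proof.
move=> /subsetP sLW; apply/eqP; rewrite eqEsubset; apply/andP; split.
  apply/subsetP=> z /mulsgP[x y /sLW]; rewrite inE => /eqP xW Wy ->.
  by rewrite -xW mem_lcoset mulKg.
by apply: mulG_subr.
Qed.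

Lemma mul_lstab W L : L * W = W -> L \subset lstab W.
Proof.
move=> LW; apply/subsetP=> x Lx; rewrite inE eqEcard card_lcoset leqnn andbT.
by rewrite -{2}LW mulSg // sub1set.
Qed.

(** Left stability makes [W] a union of right cosets of [L], so the coset [L :* y] of a missed [y]
    is disjoint from [W]. *)
Lemma lstab_card W L K y :
    L \subset lstab W -> L \subset K -> W \subset K -> y \in K :\: W ->
  #|W| + #|L| <= #|K|.
Proof.
move=> sLW sLK sWK /setDP[Ky W'y].
have sLyK: L :* y \subset K by rewrite mul_subG // sub1set.
have dis: [disjoint W & L :* y].
  rewrite -setI_eq0; apply/eqP/setP=> z; rewrite !inE mem_rcoset.
  apply/negP=> /andP[Wz Lz]; case/negP: W'y.
  rewrite -(lstab_mul sLW) -[y](mulKg (z * y^-1)) mem_mulg ?groupV //.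
  by rewrite mulgKV.
rewrite -(card_rcoset L y) -cardsUI; move: dis; rewrite -setI_eq0 => /eqP->.
by rewrite cards0 addn0 subset_leq_card // subUset sWK.
Qed.

Lemma rmul_sub W Z x : W * Z = W -> x \in W -> x *: Z \subset W.
Proof. by move=> WZ Wx; rewrite -WZ mulSg // sub1set. Qed.

Lemma rmul_dvdn W Z : W * Z = W -> #|Z| %| #|W|.
Proof.
elim: {W}_.+1 {-2}W (ltnSn #|W|) => // n IHn W ltWn WZ.
have [->|/set0Pn[x Wx]] := eqVneq W set0; first by rewrite cards0 dvdn0.
have sxW := rmul_sub WZ Wx.
rewrite -(cardsID (x *: Z) W) (setIidPr sxW) card_lcoset dvdn_addr //.
apply: IHn.
  rewrite cardsD (setIidPr sxW) card_lcoset.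
  have := cardG_gt0 Z; have : 0 < #|W| by rewrite card_gt0; apply/set0Pn; exists x.
  clia.
apply/eqP; rewrite eqEsubset mulG_subl andbT; apply/subsetP=> t.
case/mulsgP=> w z /setDP[Ww xw] Zz ->; rewrite inE -[in X in _ && X]WZ.
by rewrite (mem_mulg Ww Zz) andbT !mem_lcoset mulgA groupMr // -mem_lcoset.
Qed.

(* Elements outside U are multiplied on the left, so that the sets of partial
   products stay unions of left cosets of N, without any normality. *)
Lemma sums0_grow S U N x : x \notin U -> x \in S ->
  subset_sums0 U * N :|: x *: (subset_sums0 U * N)
    \subset subset_sums0 (x |: U) * N.
Proof.
move=> U'x Sx; rewrite subUset mulSg ?sums0_mono ?subsetUr //= mulgA mulSg //.
have dis: [disjoint [set x] & U] by rewrite disjoints1.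
by apply: subset_trans (sums0M dis); rewrite mulSg // sub_sums0.
Qed.

(** The number [c] is a surplus: [U] reaches at least [#|U| + 1 + c] cosets of [N]. In a largest
    such [U], an [x] that moved the set reached would add a whole coset of [N], so that [x |: U]
    would qualify too. The set [U0] only witnesses that some set qualifies; [U] need not contain
    it. *)
Lemma sums0_stall N T U0 c :
    U0 \subset T -> #|N| * (#|U0| + 1 + c) <= #|subset_sums0 U0 * N| ->
  exists U, [/\ U \subset T, #|N| * (#|U| + 1 + c) <= #|subset_sums0 U * N|
             & T :\: U \subset lstab (subset_sums0 U * N)].
Proof.
move=> sU0 leU0.
pose P U := (U \subset T) && (#|N| * (#|U| + 1 + c) <= #|subset_sums0 U * N|).
have PU0: P U0 by rewrite /P sU0.
case: (arg_maxnP (fun U => #|U|) PU0) => U /andP[sUT leU] maxU.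
exists U; split=> //; apply/subsetP=> x /setDP[Tx U'x].
rewrite inE; set W := subset_sums0 U * N in leU *.
have WN: W * N = W by rewrite -mulgA mulGid.
rewrite eqEcard card_lcoset leqnn andbT; apply: contraT => /subsetPn[y xWy W'y].
suff: P (x |: U) by move/maxU; rewrite cardsU1 U'x /= ltnn.
rewrite /P subUset sub1set Tx sUT cardsU1 U'x /=.
apply: leq_trans (subset_leq_card (sums0_grow N U'x Tx)); rewrite -/W.
have sy: y *: N \subset x *: W :\: W.
  apply/subsetP=> z yNz; rewrite inE; apply/andP; split.
    apply: contra W'y => Wz; apply: (subsetP (rmul_sub WN Wz)).
    by rewrite lcoset_sym.
  have xWN: (x *: W) * N = x *: W by rewrite -mulgA WN.
  exact: subsetP (rmul_sub xWN xWy) z yNz.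
move/subset_leq_card: sy; rewrite card_lcoset => leN.
have := cardsUI W (x *: W); have := cardsID W (x *: W).
by rewrite (setIC (x *: W)); clia.
Qed.

Lemma sub_sums0_mul U N : U \subset subset_sums0 U * N.
Proof. by apply: subset_trans (sub_sums0 U) _; apply: mulG_subl. Qed.

Lemma sub_sums0_mulr U N : N \subset subset_sums0 U * N.
Proof.
apply/subsetP=> x Nx; rewrite -[x]mul1g; apply: mem_mulg => //; exact: sums0_1.
Qed.

Lemma sums0_mul_sub U N K : U \subset K -> N \subset K -> subset_sums0 U * N \subset K.
Proof. by move=> sUK sNK; apply: mul_subG => //; apply: sums0_sub_group. Qed.

Lemma sums0_mul_lstab U N K :
  U \subset K -> N \subset K -> K \subset 'N(N) -> N \subset lstab (subset_sums0 U * N).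
Proof.
move=> sUK sNK nNK; apply: mul_lstab.
by rewrite -(normC (subset_trans (sums0_mul_sub sUK sNK) nNK)) -mulgA mulGid.
Qed.

Lemma sums0_stall0 N T :
  exists U, [/\ U \subset T, #|N| * #|U|.+1 <= #|subset_sums0 U * N|
             & T :\: U \subset lstab (subset_sums0 U * N)].
Proof.
have [] := @sums0_stall N T set0 0; rewrite ?sub0set //.
  by rewrite cards0 muln1 subset_leq_card ?sub_sums0_mulr.
by move=> U [sUT leU stU]; exists U; split=> //; rewrite addn0 addn1 in leU.
Qed.

Lemma fill_step Z T K0 U0 c :
    Z \subset K0 -> K0 \subset 'N(Z) -> T \subset K0 -> [disjoint T & Z] ->
    U0 \subset T -> #|Z| * (#|U0| + 1 + c) <= #|subset_sums0 U0 * Z| ->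
    #|K0 : Z| <= #|T| + 1 + c ->
  (exists U, [/\ U \subset T, subset_sums0 U * Z = K0 & #|U| < #|K0 : Z|])
  \/ exists L, [/\ Z \proper L, L \proper K0 & #|L : Z| <= #|T :&: L|].
Proof.
move=> sZK nZK sTK dTZ sU0 leU0 leK.
have [U [sUT leU stU]] := sums0_stall sU0 leU0.
set W := _ * _ in leU stU.
have sUK := subset_trans sUT sTK.
have sWK : W \subset K0 by apply: sums0_mul_sub.
have lagK := Lagrange sZK.
have [eqW | neW] := eqVneq W K0.
  left; exists U; split=> //.
  move: leU; rewrite eqW -lagK leq_pmul2l ?cardG_gt0 //; clia.
right; have [y Ky] : exists y, y \in K0 :\: W.
  by apply/set0Pn; rewrite setD_eq0; apply: contra neW => sKW; rewrite eqEsubset sWK.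
pose L := <<(T :\: U) :|: Z>>%G.
have sZL : Z \subset L by apply: sub_gen; apply: subsetUr.
have sTL : T :\: U \subset L by apply: sub_gen; apply: subsetUl.
have sLst : L \subset lstab W.
  by rewrite gen_subG subUset stU /=; apply: sums0_mul_lstab sUK sZK nZK.
have sLK : L \subset K0.
  by rewrite gen_subG subUset sZK andbT; apply: subset_trans (subsetDl _ _) sTK.
have cWL := lstab_card sLst sLK sWK Ky.
have lagL := Lagrange sZL.
have leL : #|L : Z| <= #|T :\: U|.
  rewrite cardsD (setIidPr sUT); move: cWL; rewrite -lagK -lagL => cWL.
  have : #|Z| * (#|U| + 1 + c + #|L : Z|) <= #|Z| * #|K0 : Z|.
    by rewrite mulnDr; apply: leq_trans cWL; rewrite leq_add2r.
  rewrite leq_pmul2l ?cardG_gt0 //; have := subset_leq_card sUT; clia.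
exists L; split.
- rewrite properE sZL; have : 0 < #|T :\: U| by apply: leq_trans leL; apply: indexg_gt0.
  rewrite card_gt0 => /set0Pn[t Ut]; apply/subsetPn; exists t; first exact: subsetP sTL t Ut.
  have /setDP[Tt _] := Ut; apply/negP=> Zt.
  by move/pred0P/(_ t): dTZ; rewrite /= Tt Zt.
- rewrite properEcard sLK; have := cardG_gt0 L; have : 0 < #|W|.
    rewrite card_gt0; apply/set0Pn; exists 1; apply: (subsetP (sub_sums0_mulr U Z)).
    exact: group1.
  clia.
apply: leq_trans leL _; apply: subset_leq_card.
by rewrite subsetI subsetDl.
Qed.

(** Descent on [#|K0|]: a stall yields a smaller subgroup, still properly containing [Z], for which
    the counting hypothesis holds again. *)
Lemma fill_subgroup Z T K0 :
    Z \proper K0 -> K0 \subset 'N(Z) -> [disjoint T & Z] ->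
    #|K0 : Z| <= #|T :&: K0| + 1 ->
  exists K U, [/\ Z \proper K, K \subset K0, U \subset T,
                  subset_sums0 U * Z = K & #|U| < #|K : Z|].
Proof.
elim: {K0}_.+1 {-2}K0 (ltnSn #|K0|) => // n IHn K0 ltK0 pZK nZK dTZ leK.
have dZ : [disjoint T :&: K0 & Z] by apply: disjointWl dTZ; apply: subsetIl.
have le0 : #|Z| * (#|@set0 gT| + 1 + 0) <= #|subset_sums0 set0 * Z|.
  by rewrite cards0 muln1 subset_leq_card ?sub_sums0_mulr.
have leK0 : #|K0 : Z| <= #|T :&: K0| + 1 + 0 by rewrite addn0.
have [] := fill_step (proper_sub pZK) nZK (subsetIr T K0) dZ (sub0set _) le0 leK0.
  case=> U [sU eqU ltU]; exists K0, U; split=> //.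
  by apply: subset_trans sU (subsetIl _ _).
case=> L [pZL pLK leL].
have ltL : #|L| < n by have := proper_card pLK; clia.
have nZL := subset_trans (proper_sub pLK) nZK.
have leL' : #|L : Z| <= #|T :&: L| + 1.
  by rewrite -setIA (setIidPr (proper_sub pLK)) in leL; clia.
have [K [U [pZK' sKL sUT eqU ltU]]] := IHn L ltL pZL nZL dTZ leL'.
by exists K, U; split=> //; apply: subset_trans sKL (proper_sub pLK).
Qed.

(** Proper subgroups of a nilpotent group are smaller than their normalisers. *)
Lemma nilpotent_maximal_normal G M : nilpotent G -> maximal M G -> M <| G.
Proof.
move=> nilG maxM; have /maxgroupP[pMG maxM'] := maxM.
rewrite /normal (proper_sub pMG) /=.
have pMN := nilpotent_proper_norm nilG pMG.
apply: contraT => nN; have pNG : 'N_G(M) \proper G.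
  by rewrite properE subsetIl subsetI subxx.
by have := maxM' _ pNG (proper_sub pMN) => eqN; rewrite eqN properxx in pMN.
Qed.

(** If some [x] in [X] is left over after stalling, the stabiliser contains [M] and [x], hence [G]
    by maximality. If none is left, every element of [X] has gained a coset and the count
    suffices. *)
Lemma fill_index G M X :
    M <| G -> maximal M G -> X \subset G :\: M -> #|G : M| <= #|X|.+1 ->
  subset_sums0 X * M = G.
Proof.
move=> /andP[sMG nMG] maxM sX leX.
have sXG := subset_trans sX (subsetDl _ _).
have [U [sUX leU stU]] := sums0_stall0 M X; have sUG := subset_trans sUX sXG.
suff eqU: subset_sums0 U * M = G.
  apply/eqP; rewrite eqEsubset sums0_mul_sub //= -eqU; apply: mulSg; exact: sums0_mono.
have sWG := sums0_mul_sub sUG sMG.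
have [sXU | /subsetPn[x Xx U'x]] := boolP (X \subset U).
  have eqXU: U = X by apply/eqP; rewrite eqEsubset sUX.
  apply/eqP; rewrite eqEcard sWG; apply: leq_trans leU; rewrite -(Lagrange sMG).
  by rewrite leq_mul2l eqXU leX orbT.
set W := _ * _ in leU stU sWG *.
have sMW : M \subset lstab W by apply: sums0_mul_lstab sUG sMG nMG.
have [Gx M'x] := setDP (subsetP sX x Xx).
pose L := <<x |: M>>%G.
have sLW : L \subset lstab W.
  by rewrite gen_subG subUset sMW sub1set (subsetP stU) // inE U'x.
have sLG : L \subset G by rewrite gen_subG subUset sMG sub1set Gx.
have eqLG : L :=: G.
  apply/eqP; apply: contraT => neL.
  have pLG : L \proper G by rewrite properEneq neL.
  have /maxgroupP[_ maxM'] := maxM.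
  have eqL := maxM' _ pLG (subset_trans (subsetUr _ _) (subset_gen _)).
  by case/negP: M'x; rewrite -eqL mem_gen // setU11.
apply/eqP; rewrite eqEsubset sWG -(lstab_mul sLW) eqLG.
apply/subsetP=> z Gz; rewrite -[z]mulg1; apply: mem_mulg => //.
by apply: (subsetP (sub_sums0_mulr U M)); exact: group1.
Qed.

(** By size, [A] and [y *: A^-1] share two elements. Each common [c] writes [y] as [c * (c^-1 * y)]
    with both factors in [A], and the factors coincide only if [c * c = y]. Squaring is injective in
    odd order, so one of the two choices works. *)
Lemma sums_half H A :
  odd #|H| -> A \subset H -> #|H| + 2 <= 2 * #|A| -> subset_sums A = H.
Proof.
move=> oddH sAH leA; apply/eqP; rewrite eqEsubset sums_sub_group //=.
apply/subsetP=> y Hy.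
pose B := A :&: y *: A^-1.
have sBH : A :|: y *: A^-1 \subset H.
  by rewrite subUset sAH mul_subG ?sub1set // -invSg invgK (subset_trans sAH) ?invGid.
have leB : 1 < #|B|.
  have := cardsUI A (y *: A^-1); rewrite card_lcoset card_invg -/B.
  by have := subset_leq_card sBH; clia.
have /card_gt1P[a [b [Ba Bb nab]]] := leB.
have key c : c \in B -> c * c != y -> y \in subset_sums A.
  rewrite inE mem_lcoset mem_invg invMg invgK => /andP[Ac Ad] ne; apply/subset_sumsP; exists [:: c; c^-1 * y].
  split=> //=; last by rewrite !big_cons big_nil mulg1 mulKVg.
    by rewrite inE andbT; apply: contra ne => /eqP e; rewrite {2}e mulKVg.
  by move=> d; rewrite !inE => /orP[] /eqP->.
have [ea | /(key a Ba)//] := eqVneq (a * a) y.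
have [eb | /(key b Bb)//] := eqVneq (b * b) y.
have co2 : coprime #|H| 2 by rewrite coprimen2.
case/eqP: nab; apply: (can_in_inj (expgK co2)).
- by apply: (subsetP sAH); case/setIP: Ba.
- by apply: (subsetP sAH); case/setIP: Bb.
by rewrite !expgS !expg0 !mulg1 ea eb.
Qed.
End Growth.

(** * Maximal subgroups and full cosets of a central subgroup *)

(** This is [(x - p) * (y - p) >= 0] divided by [p]. It is applied to pairs of complementary
    indices, or to an index and an order. *)
Lemma divisor_sum_le p N x y :
  0 < p -> p <= x -> p <= y -> x * y = p * N -> x + y <= p + N.
Proof.
move=> p_gt0 /subnKC<- /subnKC<-; set a := x - p; set b := y - p => eqN.
have : p * (p + a + b) <= p * N by rewrite -eqN; nia.
by rewrite leq_pmul2l //; lia.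
Qed.

Section Stage.
Import GroupScope.
Variable gT : finGroupType.
Implicit Types (A B C D S T U W X Y : {set gT}) (G H K L M N Z : {group gT}) (x y g : gT).

(* The stabiliser L of the stalled set B either lies in a conjugate of K, and
   then a normal maximal subgroup contains both L and K, or each double coset
   L g K missed by B has at least p |K| elements. *)
Lemma fill_quotient G Z K X U r :
    nilpotent G -> Z \proper K -> K \proper G -> X \subset G ->
    U \subset X -> U \subset K -> #|U| < #|K : Z| ->
    #|G : Z| = (pdiv #|G| * r)%N ->
  (exists U2, [/\ U2 \subset X :\: U, subset_sums0 U2 * K = G & #|U2| < #|G : K|])
  \/ exists2 M : {group gT}, maximal M G & #|X| + 2 <= #|X :&: M| + r.
Proof.
move=> nilG pZK pKG sXG sUX sUK ltU eqr; set p := pdiv #|G| in eqr *.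
have [sZK sKG] := (proper_sub pZK, proper_sub pKG).
have dvd_ge d : 1 < d -> d %| #|G| -> p <= d by move=> ? ?; apply: pdiv_min_dvd.
have xy : (#|G : K| * #|K : Z|)%N = (p * r)%N by rewrite -eqr Lagrange_index.
have lx : p <= #|K : Z|.
  apply: dvd_ge; first by rewrite indexg_gt1 proper_subn.
  by apply: dvdn_trans (dvdn_indexg _ _) (cardSg sKG).
have ly : p <= #|G : K|.
  by apply: dvd_ge; rewrite ?indexg_gt1 ?proper_subn ?dvdn_indexg.
have sumxy : #|G : K| + #|K : Z| <= p + r := divisor_sum_le (pdiv_gt0 _) ly lx xy.
have [U2 [sU2 leU2 stU2]] := sums0_stall0 K (X :\: U).
have sU2X := subset_trans sU2 (subsetDl _ _).
have sU2G := subset_trans sU2X sXG.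
set B := _ * _ in leU2 stU2.
have sBG : B \subset G by apply: sums0_mul_sub.
have BK : B * K = B by rewrite -mulgA mulGid.
have lagK := Lagrange sKG.
have [eqB | neB] := eqVneq B G.
  left; exists U2; split=> //; move: leU2.
  by rewrite eqB -lagK leq_pmul2l ?cardG_gt0.
right; have [g /setDP[Gg B'g]] : exists g, g \in G :\: B.
  by apply/set0Pn; rewrite setD_eq0; apply: contra neB => sGB; rewrite eqEsubset sBG.
pose L := <<X :\: U :\: U2>>%G.
have sLB : L \subset lstab B by rewrite gen_subG.
have sLG : L \subset G by rewrite gen_subG (subset_trans (subsetDl _ _)) ?(subset_trans (subsetDl _ _)).
have LB := lstab_mul sLB.
have pLG : L \proper G.
  rewrite properE sLG; apply/negP=> sGL; case/negP: B'g; rewrite -LB.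
  rewrite -[g]mulg1; apply: mem_mulg; first exact: subsetP sGL g Gg.
  apply: (subsetP (sub_sums0_mulr U2 K)); exact: group1.
have LgKG : L * (g *: K) \subset G by rewrite !mul_subG ?sub1set.
have disLgK : [disjoint B & L * (g *: K)].
  rewrite -setI_eq0; apply/eqP/setP=> t; rewrite !inE; apply/negP=> /andP[Bt].
  case/mulsgP=> l z Ll /lcosetP[k Kk ->] et; case/negP: B'g.
  have -> : g = l^-1 * t * k^-1 by rewrite et !mulgA mulVg mul1g mulgK.
  by rewrite -BK -{1}LB !mem_mulg ?groupV.
have cB : #|B| + #|L * (g *: K)| <= #|G|.
  have := cardsUI B (L * (g *: K)).
  move: disLgK; rewrite -setI_eq0 => /eqP->; rewrite cards0.
  have : B :|: L * (g *: K) \subset G by rewrite subUset sBG.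
  by move/subset_leq_card; clia.
have leU2X : #|X :\: U| = #|X| - #|U| by rewrite cardsD (setIidPr sUX).
have [sLK | nLK] := boolP (L \subset K :^ g^-1).
  have pKg : K :^ g^-1 \proper G.
    by rewrite -(conjGid (groupVr Gg)) properJ.
  have [eqG | [M maxM sKgM]] := maximal_exists (proper_sub pKg).
    by move: pKg; rewrite [_ :^ _]eqG properxx.
  have nMG := nilpotent_maximal_normal nilG maxM.
  exists M => //.
  have sKM : K \subset M.
    by rewrite -(conjSg _ _ g^-1) (normsP (normal_norm nMG)) ?groupV.
  have sXM : X :\: U2 \subset X :&: M.
    rewrite subsetI subsetDl; apply/subsetP=> t /setDP[Xt U2't].
    have [Ut | U't] := boolP (t \in U).
      by apply: (subsetP sKM); apply: (subsetP sUK).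
    apply: (subsetP sKgM); apply: (subsetP sLK); apply: mem_gen.
    by rewrite !inE U't U2't.
  have := subset_leq_card sXM; rewrite cardsD (setIidPr sU2X) => leX.
  (* Only elements of [U2] may lie outside [M], and [#|G : K| <= r] because [p <= #|K : Z|]. *)
  have : #|K| * #|U2|.+2 <= #|K| * #|G : K|.
    rewrite lagK; apply: leq_trans cB.
    have : #|K| <= #|L * (g *: K)|.
      by rewrite -(card_lcoset K g) subset_leq_card // mulG_subr.
    by move: leU2; rewrite !mulnS; clia.
  rewrite leq_pmul2l ?cardG_gt0 // => lt2.
  have := subset_leq_card sU2X; clia.
(* The index in [L] of its intersection with [K :^ g^-1] is a divisor of [#|G|] exceeding 1, hence
   at least [p]. *)
have cLgK : #|K| * p <= #|L * (g *: K)|.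
  have -> : L * (g *: K) = L * (K :^ g^-1) * [set g].
    by rewrite conjsgE invgK -!mulgA mulg_set1 mulVg mulg1.
  rewrite card_rcoset -LagrangeMr cardJg mulnC leq_mul2r; apply/orP; right.
  apply: dvd_ge; first by rewrite indexg_gt1.
  exact: dvdn_trans (dvdn_indexg _ _) (cardSg sLG).
have [eqG | [M maxM sLM]] := maximal_exists sLG.
  by move: pLG; rewrite eqG properxx.
exists M => //.
have sXM : X :\: U :\: U2 \subset X :&: M.
  rewrite subsetI (subset_trans (subsetDl _ _) (subsetDl _ _)).
  exact: subset_trans (subset_gen _) sLM.
have := subset_leq_card sXM; rewrite cardsD (setIidPr sU2) leU2X => leX.
have : #|K| * (#|U2| + 1 + p) <= #|K| * #|G : K|.
  rewrite lagK; apply: leq_trans cB; move: leU2 cLgK; rewrite -addn1 !mulnDr; clia.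
(* Together with [#|U| < #|K : Z|] and [sumxy], this leaves at most [r - 2] elements of [X] outside
   [M]. *)
rewrite leq_pmul2l ?cardG_gt0 // => lt2.
have := subset_leq_card sUX; have := subset_leq_card sU2; rewrite leU2X; clia.
Qed.

(** Here [S :&: M] fills [M] by [sums_half], and [S :\: M] reaches every coset of [M]. It has enough
    elements because [#|S :&: M| < #|M|] and [#|G : M| + #|M| <= p + N]. *)
Lemma sums_of_maximal G S M (N : nat) :
    nilpotent G -> odd #|G| -> S \subset G :\ 1 -> #|G| = (pdiv #|G| * N)%N ->
    N + pdiv #|G| <= #|S| + 2 -> maximal M G -> #|M| + 2 <= 2 * #|S :&: M| ->
  subset_sums S = G.
Proof.
move=> nilG oddG sSG eqN leS maxM leM; set p := pdiv #|G| in eqN leS.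
have dvd_ge d : 1 < d -> d %| #|G| -> p <= d by move=> ? ?; apply: pdiv_min_dvd.
have nMG := nilpotent_maximal_normal nilG maxM; have sMG := normal_sub nMG.
have pMG := maxgroupp maxM.
have lag := Lagrange sMG.
have ltSM : #|S :&: M| < #|M|.
  rewrite [X in _ < X](cardsD1 1) group1 add1n ltnS subset_leq_card //.
  rewrite subsetD subsetIr -setI_eq0; apply/eqP/setP=> t; rewrite !inE.
  by apply/negP=> /andP[/andP[/(subsetP sSG)]]; rewrite !inE => /andP[/negPf->].
have sum := @divisor_sum_le p N #|G : M| #|M| (pdiv_gt0 _).
have {sum} sum : #|G : M| + #|M| <= p + N.
  apply: sum; last by rewrite mulnC lag.
    by apply: dvd_ge; rewrite ?indexg_gt1 ?proper_subn ?dvdn_indexg.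
  apply: dvd_ge (cardSg sMG); move: ltSM leM; clia.
have sSG' := subset_trans sSG (subsetDl _ _).
have fillM : subset_sums0 (S :\: M) * M = G.
  apply: fill_index => //; first exact: setSD.
  have := cardsID M S; clia.
have eqM : subset_sums (S :&: M) = M.
  by apply: sums_half; rewrite ?subsetIr ?(oddSg sMG).
apply: (sums_of_coset (g := 1) nMG sSG' (subsetIl S M) (subsetDl S M) _ _ fillM).
  by rewrite -setI_eq0; apply/eqP/setP=> t; rewrite !inE; case: (t \in M); rewrite ?andbF.
by rewrite eqM mul1g.
Qed.

(** Dyson transform: replacing [A] by [A :|: a *: B] and [B] by [B :&: a^-1 *: A] keeps the sum of
    the sizes, does not enlarge the product set and keeps [1] in the second set. A suitable [a]
    makes the second set smaller. *)
Lemma cauchy_davenport_aux Z A B : prime #|Z| -> A \subset Z -> B \subset Z ->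
  A != set0 -> 1 \in B -> minn #|Z| (#|A| + #|B|).-1 <= #|A * B|.
Proof.
move=> prZ; elim: {B}_.+1 {-2}B (ltnSn #|B|) A => // n IHn B ltB A sAZ sBZ nzA B1.
have abZ := cyclic_abelian (prime_cyclic prZ).
have sAAB : A \subset A * B by apply/subsetP=> a Aa; rewrite -[a]mulg1 mem_mulg.
have [sB1 | /subsetPn[b Bb b1]] := boolP (B \subset [1]).
  apply: leq_trans (geq_minr _ _) _; have := subset_leq_card sAAB.
  by have := subset_leq_card sB1; rewrite cards1; clia.
(* When no transform shrinks [B], some nontrivial element of [Z] stabilises [A]; as [#|Z|] is prime,
   all of [Z] does. *)
have [stAB | /forall_inPn[a Aa nsaB]] := boolP [forall (a | a \in A), a *: B \subset A].
  apply: leq_trans (geq_minl _ _) _; apply: leq_trans (subset_leq_card sAAB).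
  have stA : Z \subset lstab A.
    have sBst : B \subset lstab A.
      apply/subsetP=> c Bc; rewrite inE eqEcard card_lcoset leqnn andbT.
      apply/subsetP=> t /lcosetP[a Aa ->].
      rewrite -(centsP abZ a (subsetP sAZ a Aa) c (subsetP sBZ c Bc)).
      by apply: (subsetP (forall_inP stAB a Aa)); rewrite mem_lcoset mulKg.
    have [//|] := prime_subgroupVti (lstab_group A) prZ.
    move/trivgP/subsetP/(_ b); rewrite inE (subsetP sBst b Bb) (subsetP sBZ b Bb).
    by move/(_ isT) => b1'; rewrite b1' in b1.
  case/set0Pn: nzA => a Aa; rewrite -(card_rcoset Z a) subset_leq_card //.
  by rewrite -(lstab_mul stA) mulgS // sub1set.
pose A' := A :|: a *: B; pose B' := B :&: a^-1 *: A.
have sA'Z : A' \subset Z.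
  by rewrite subUset sAZ mul_subG // sub1set (subsetP sAZ).
have ltB' : #|B'| < #|B|.
  apply: proper_card; rewrite properE subsetIl; apply: contra nsaB => sBB'.
  apply/subsetP=> t /lcosetP[c /(subsetP sBB')].
  by rewrite inE mem_lcoset invgK => /andP[_ Aac] ->.
have sA'B' : A' * B' \subset A * B.
  apply/subsetP=> t /mulsgP[c d]; rewrite !inE (mem_lcoset A) invgK.
  case/orP=> [Ac | /lcosetP[e Be ->]] /andP[Bd Aad] ->; first exact: mem_mulg.
  rewrite -mulgA (centsP abZ e (subsetP sBZ e Be) d (subsetP sBZ d Bd)) mulgA.
  exact: mem_mulg.
have sB'Z : B' \subset Z by apply: subset_trans (subsetIl _ _) sBZ.
have nzA' : A' != set0.
  by case/set0Pn: nzA => c Ac; apply/set0Pn; exists c; rewrite inE Ac.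
have B'1 : 1 \in B' by rewrite inE B1 mem_lcoset invgK mulg1.
have := IHn B' (leq_trans ltB' ltB) A' sA'Z sB'Z nzA' B'1.
have -> : #|A'| + #|B'| = #|A| + #|B|.
  rewrite -(card_lcoset B a) -(cardsUI A) -/A'; congr (_ + _).
  rewrite -(card_lcoset B' a); congr #|pred_of_set _|.
  by apply/setP=> t; rewrite !inE !mem_lcoset !inE mem_lcoset invgK mulKVg andbC.
by move=> le; apply: leq_trans le (subset_leq_card sA'B').
Qed.

Lemma cauchy_davenport Z A B : prime #|Z| -> A \subset Z -> B \subset Z ->
  A != set0 -> B != set0 -> minn #|Z| (#|A| + #|B|).-1 <= #|A * B|.
Proof.
move=> prZ sAZ sBZ nzA /set0Pn[b Bb].
have Zb := subsetP sBZ b Bb.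
have sB'Z : B :* b^-1 \subset Z by rewrite mul_subG // sub1set groupV.
have := cauchy_davenport_aux prZ sAZ sB'Z nzA.
by rewrite mulgA !card_rcoset mem_rcoset invgK mul1g; apply.
Qed.

Lemma subset_card A n : n <= #|A| -> exists2 B : {set gT}, B \subset A & #|B| = n.
Proof.
case/card_geqP=> s [us <- sA]; exists [set x in s].
  by apply/subsetP=> x; rewrite inE => /sA.
by rewrite cardsE; apply/card_uniqP.
Qed.

(** Greedy choice: take the fibre of [S] over a [Z]-coset of largest size [s]. It gains [s - 1] in
    Cauchy-Davenport, so [j] counts the cosets used. The size of the last fibre chosen from is [m];
    the [j - 1] earlier ones are at least as large, whence the bound on [j.-1 * m.-1]. The final
    clause lets the induction compare [m] with [s]. *)
Lemma sum_coset_choice Z S w : prime #|Z| -> S \subset 'C(Z) -> 0 < w -> w < #|Z| ->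
    w + #|lcosets Z S| <= #|S| ->
  exists S1 C g j m,
    [/\ S1 \subset S, C \subset Z, g *: C \subset subset_sums S1, w < #|C|
       & #|S1| = w + j]
    /\ [/\ 0 < j <= w, 1 < m, j.-1 * m.-1 < w,
           forall x, #|(S :\: S1) :&: x *: Z| <= m
         & exists x, m <= #|S :&: x *: Z|].
Proof.
move=> prZ; elim: {w}_.+1 {-2}w (ltnSn w) S => // n IHn w ltw S cSZ w0 wZ leS.
have [x _ maxx] := @arg_maxnP _ (1 : gT) xpredT (fun x => #|S :&: x *: Z|) isT.
set s := #|S :&: x *: Z| in maxx.
(* With at most one element per coset, [S] would meet as many cosets as it has elements, against
   [0 < w]. *)
have s2 : 1 < s.
  rewrite ltnNge; apply/negP=> s1.
  have : #|lcosets Z S| = #|S|.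
    apply: card_in_imset => a b Sa Sb eqab; apply/eqP; apply: contraT => nab.
    have : 1 < #|S :&: a *: Z|.
      apply/card_gt1P; exists a, b; rewrite !inE Sa Sb lcoset_refl; split=> //.
      rewrite -lcosetE eqab lcosetE; exact: lcoset_refl.
    by have := maxx a isT; rewrite /geq /=; clia.
  clia.
have abZ := cyclic_abelian (prime_cyclic prZ).
pose D := S :&: x *: Z.
have sDS : D \subset S by apply: subsetIl.
have [ltws | lesw] := ltnP w s.
  have [S1 sS1D cS1] := subset_card ltws.
  exists S1, (x^-1 *: S1), x, 1%N, s; split; split=> //.
  - exact: subset_trans sS1D sDS.
  - apply/subsetP=> t /lcosetP[d /(subsetP sS1D)].
    by rewrite inE mem_lcoset => /andP[_ Zd] ->.
  - by rewrite -lcosetM mulgV mul1g sub_sums.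
  - by rewrite card_lcoset cS1.
  - by rewrite cS1 addn1.
  - by move=> y; apply: leq_trans (maxx y isT); rewrite subset_leq_card // setSI // subsetDl.
  by exists x.
pose S' := S :\: x *: Z; pose w' := w - s.-1.
have sS'S : S' \subset S by apply: subsetDl.
have cS' : #|S'| = #|S| - s by rewrite cardsD.
have cos' : #|lcosets Z S'| < #|lcosets Z S|.
  apply: proper_card; rewrite properE imsetS //=; apply/subsetPn; exists (x *: Z).
    have : 0 < s by clia.
    rewrite card_gt0 => /set0Pn[t /setIP[St xt]]; apply/lcosetsP; exists t => //.
    by apply/esym/lcoset_eqP.
  apply/lcosetsP=> -[t /setDP[_ xt]] eqx; case/negP: xt; rewrite eqx.
  exact: lcoset_refl.
have w'0 : 0 < w' by rewrite /w'; clia.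
have lew' : w' < w by rewrite /w'; clia.
have leS' : w' + #|lcosets Z S'| <= #|S'|.
  by have := subset_leq_card sDS; rewrite -/s cS' /w'; clia.
have [S1 [C [g [j [m [[sS1 sCZ sgC ltC cS1] [/andP[j0 jw] m1 jm mle [y my]]]]]]]] :=
  IHn w' (leq_trans lew' ltw) S' (subset_trans sS'S cSZ) w'0 (ltn_trans lew' wZ) leS'.
have dD : [disjoint D & S1].
  apply: disjointWr sS1 _; rewrite -setI_eq0; apply/eqP/setP=> t.
  by rewrite !inE; case: (_ \in x *: Z); rewrite ?andbF.
have sDxZ : x^-1 *: D \subset Z.
  by apply/subsetP=> t /lcosetP[d /setIP[_]]; rewrite mem_lcoset => Zd ->.
have nz A : 0 < #|A| -> A != set0 by rewrite card_gt0.
have le_m_s : m <= s.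
  apply: leq_trans my _; apply: leq_trans (maxx y isT).
  by rewrite subset_leq_card // setSI.
exists (D :|: S1), ((x^-1 *: D) * C), (x * g), j.+1, m; split; split=> //.
- by rewrite subUset sDS (subset_trans sS1).
- by rewrite mul_subG.
- apply/subsetP=> t /lcosetP[u /mulsgP[d c /lcosetP[e De ->] Cc ->] ->].
  apply: (subsetP (subset_trans (sums0M_sums dD) (subxx _))).
  have gC : g \in 'C(Z).
    have /set0Pn[c0 Cc0] : C != set0 by apply: nz; clia.
    have Zc0 := subsetP sCZ c0 Cc0.
    rewrite -(groupMr g (subsetP abZ c0 Zc0)).
    apply: (subsetP (sums_sub_group (subset_trans sS1 (subset_trans sS'S cSZ)))).
    by apply: (subsetP sgC); rewrite mem_lcoset mulKg.
  have -> : x * g * (x^-1 * e * c) = e * (g * c).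
    have cgd : commute g (x^-1 * e).
      apply: (centP gC); apply: (subsetP sDxZ); apply/lcosetP; by exists e.
    by rewrite -(mulgA x) (mulgA g) cgd -!mulgA mulKVg.
  apply: mem_mulg; first exact: (subsetP (sub_sums0 D)).
  by apply: (subsetP sgC); rewrite mem_lcoset mulKg.
- have := @cauchy_davenport Z (x^-1 *: D) C prZ sDxZ sCZ.
  rewrite card_lcoset -/s => CD; apply: leq_trans (CD _ _).
  + by rewrite leq_min wZ /=; move: ltC; rewrite /w'; clia.
  + by apply: nz; rewrite card_lcoset -/s; clia.
  by apply: nz; clia.
- rewrite cardsU; move: dD; rewrite -setI_eq0 => /eqP->; rewrite cards0 -/s.
  by rewrite cS1 /w'; clia.
- by move: jw; rewrite /w'; clia.
- case: j j0 jm {cS1 jw} => // j _; rewrite /= mulSn.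
  have : m.-1 <= s.-1 by clia.
  have : w' + s.-1 = w by rewrite /w'; clia.
  by clia.
- move=> t; apply: leq_trans (mle t); apply: subset_leq_card; apply/subsetP=> u.
  by rewrite !inE; case: (u \in S); case: (u \in S1); case: (u \in x *: Z).
by exists y; apply: leq_trans my _; rewrite subset_leq_card // setSI.
Qed.

End Stage.

(** * Steps gaining more than one coset *)

Section Gain.
Import GroupScope.
Variable gT : finGroupType.
Implicit Types (A B C D S T U W X Y : {set gT}) (G H K L M N Z : {group gT}) (x y g : gT).

(** The elements of [S :&: Z] all go into [S1], so that the rest of [S] avoids [Z]. With the
    identity they form a subset of [Z], and [sum_coset_choice] on [S :\: Z] supplies the missing
    [w]. The counts match since [S :\: Z] does not meet the coset [Z]. *)
Lemma full_coset G Z S :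
    prime #|Z| -> odd #|Z| -> Z \subset 'Z(G) -> S \subset G :\ 1 ->
    #|G : Z| + #|Z| <= #|S| + 2 ->
  exists S1 g j m,
    [/\ S1 \subset S, S :&: Z \subset S1, g *: Z \subset subset_sums S1,
        #|S1| + 1 = #|Z| + j & j < #|Z|]
    /\ (forall x, #|(S :\: S1) :&: x *: Z| <= m)
    /\ (j = 0 \/ [/\ 0 < j, 1 < m & j.-1 * m.-1 + 1 < #|Z|])%N.
Proof.
move=> prZ oddZ sZZG sSG leS.
have sSG' := subset_trans sSG (subsetDl _ _).
have sZG := subset_trans sZZG (center_sub G).
have cSZ : S \subset 'C(Z).
  by apply: subset_trans sSG' _; rewrite centsC (subset_trans sZZG) ?subsetIr.
have sSZ1 : S :&: Z \subset Z :\ 1.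
  by apply/subsetP=> t; rewrite !inE => /andP[/(subsetP sSG)]; rewrite !inE => /andP[-> _] ->.
have cZ1 : #|Z :\ 1| + 1 = #|Z| by rewrite addn1 [RHS](cardsD1 1) group1 add1n.
have leSZ := subset_leq_card sSZ1.
have abZ := cyclic_abelian (prime_cyclic prZ).
have := leSZ; rewrite leq_eqVlt => /orP[/eqP eqSZ | ltSZ].
  have {}eqSZ : S :&: Z = Z :\ 1 by apply/eqP; rewrite eqEcard sSZ1 eqSZ leqnn.
  (* The nonidentity elements of [Z] already give [Z]: the identity is [y * y^-1], with distinct
     factors since [#|Z|] is odd. For [j = 0] the trivial bound [#|S|] serves as [m]. *)
  exists (S :&: Z), 1, 0%N, #|S|; split; last split; last by left.
    split; rewrite ?subsetIl ?addn0 ?eqSZ ?prime_gt0 //.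
    rewrite mul1g; apply/subsetP=> z Zz.
    have [-> | nz1] := eqVneq z 1; last first.
      by apply: (subsetP (sub_sums _)); rewrite !inE nz1.
    have /trivgPn[y Zy ny1] : Z :!=: 1 by rewrite -cardG_gt1 prime_gt1.
    apply/subset_sumsP; exists [:: y; y^-1]; split=> //=.
    - rewrite inE andbT; apply: contra ny1 => /eqP ey; rewrite -order_eq1.
      have y2 : #[y] %| 2 by rewrite order_dvdn expgS expg1 {2}ey mulgV.
      have := dvdn_odd (order_dvdG Zy) oddZ.
      by have := @dvdn_leq _ 2 isT y2; have := order_gt0 y; case: #[y] => [|[|[|]]].
    - by move=> t; rewrite !inE => /orP[] /eqP->; rewrite ?eq_invg1 ?groupV ny1.
    by rewrite !big_cons big_nil mulg1 mulgV.
  by move=> x; rewrite subset_leq_card // subIset // subsetDl.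
pose w := #|Z :\ 1| - #|S :&: Z|.
have w0 : 0 < w by rewrite /w; clia.
have wZ : w < #|Z| by rewrite /w; clia.
have cosS : #|lcosets Z (S :\: Z)| < #|G : Z|.
  rewrite -card_lcosets; apply: proper_card; rewrite properE; apply/andP; split.
    by rewrite imsetS // (subset_trans (subsetDl _ _)).
  apply/subsetPn; exists (1 *: Z); first by apply/lcosetsP; exists 1.
  apply/lcosetsP=> -[t /setDP[_ nZt] /esym/lcoset_eqP]; rewrite mul1g => Zt.
  by rewrite Zt in nZt.
have leSD : w + #|lcosets Z (S :\: Z)| <= #|S :\: Z|.
  by have := cardsID Z S; rewrite /w; clia.
have [S1 [C [g [j [m [[sS1 sCZ sgC ltC cS1] [/andP[j0 jw] m1 jm mle _]]]]]]] :=
  sum_coset_choice prZ (subset_trans (subsetDl S Z) cSZ) w0 wZ leSD.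
have dS1 : [disjoint S :&: Z & S1].
  apply: disjointWr sS1 _; rewrite -setI_eq0; apply/eqP/setP=> t.
  by rewrite !inE; case: (t \in Z); rewrite ?andbF.
pose A := 1 |: (S :&: Z).
have sAZ : A \subset Z by rewrite subUset sub1set group1 subsetIr.
have cA : #|A| = #|S :&: Z|.+1.
  rewrite cardsU1; have -> : 1 \notin S :&: Z by apply/negP=> /(subsetP sSZ1); rewrite !inE eqxx.
  by rewrite add1n.
have AC : A * C = Z.
  apply/eqP; rewrite eqEcard mul_subG //=.
  apply: leq_trans (cauchy_davenport prZ sAZ sCZ _ _).
  - by rewrite leq_min leqnn cA; move: ltC; rewrite /w; clia.
  - by rewrite -card_gt0 cA.
  by rewrite -card_gt0; apply: leq_ltn_trans ltC.
exists ((S :&: Z) :|: S1), g, j, m; split; last split.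
- split.
  + by rewrite subUset subsetIl; apply: subset_trans sS1 (subsetDl _ _).
  + exact: subsetUl.
  + rewrite -[X in g *: X]AC; apply: subset_trans (sums0M_sums dS1).
    apply/subsetP=> t /lcosetP[u /mulsgP[a c Aa Cc ->] ->].
    have gcC : g * c \in 'C(Z).
      apply: (subsetP (sums_sub_group (subset_trans sS1 (subset_trans (subsetDl _ _) cSZ)))).
      by apply: (subsetP sgC); rewrite mem_lcoset mulKg.
    have Za := subsetP sAZ a Aa.
    rewrite (centsP abZ a Za c (subsetP sCZ c Cc)) mulgA (centP gcC a Za).
    apply: mem_mulg; last by apply: (subsetP sgC); rewrite mem_lcoset mulKg.
    apply: (subsetP _ a Aa).
    by rewrite subUset sub1set sums0_1 sub_sums0.
  + rewrite cardsU; move: dS1; rewrite -setI_eq0 => /eqP->; rewrite cards0.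
    by rewrite cS1 /w; clia.
  by apply: leq_ltn_trans jw wZ.
- move=> x; apply: leq_trans (mle x); apply: subset_leq_card; apply: setSI.
  by apply/subsetP=> t; rewrite !inE negb_or; case: (t \in S); rewrite /= ?andbF // !andbT andbC.
by right; split=> //; rewrite addn1; apply: leq_ltn_trans jm wZ.
Qed.

(** Double counting: each [v] in [W] lies in [y *: W] for exactly [#|W|] values of [y]. *)
Lemma sum_card_lcosetI W : \sum_(y : gT) #|y *: W :&: W| = (#|W| * #|W|)%N.
Proof.
transitivity (\sum_(y : gT) \sum_(v in W) (v \in y *: W)).
  apply: eq_bigr => y _; rewrite -sum1_card big_mkcond [RHS]big_mkcond /=.
  by apply: eq_bigr => v _; rewrite inE andbC; case: (v \in W); case: (v \in _).
rewrite exchange_big /= -sum_nat_const; apply: eq_bigr => v Wv.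
rewrite -big_mkcond sum1_card -[RHS](card_invg W) -(card_lcoset _ v).
by apply: eq_card => y; rewrite !mem_lcoset mem_invg invMg invgK; exact: mem_lcoset.
Qed.

(** In the sum of all overlaps, a translate by [x * z] equals the one by [x], so [T * Z] contributes
    at least [a] per element. The disjoint set [Z] contributes [#|W|] per element. *)
Lemma translate_average Z T W a :
    W * Z = W -> Z \subset lstab W -> [disjoint T & Z] ->
    (forall x, x \in T -> a <= #|x *: W :&: W|) ->
  #|T * Z| * a + #|Z| * #|W| <= #|W| * #|W|.
Proof.
move=> WZ stZ dTZ leT; rewrite -sum_card_lcosetI.
rewrite (bigID (fun y => y \in T * Z)) /= leq_add //.
  rewrite -sum_nat_const; apply: leq_sum => y /mulsgP[x z Tx Zz ->].
  apply: leq_trans (leT x Tx) _; rewrite lcosetM.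
  by have := subsetP stZ z Zz; rewrite inE => /eqP->.
rewrite -sum_nat_const [leqRHS](bigID (fun y => y \in Z)) /=.
apply: leq_trans (leq_addr _ _); apply: eq_leq; apply: eq_big => [y | y Zy].
  apply/idP/andP=> [Zy | [_ ->]] //; split=> //.
  apply/mulsgP=> -[x z Tx Zz ey]; move/pred0P/(_ x): dTZ.
  by rewrite /= Tx -(groupMr x Zz) -ey Zy.
by have := subsetP stZ y Zy; rewrite inE => /eqP->; rewrite setIid.
Qed.

Lemma card_mul_multiplicity Z T m :
  (forall x, #|T :&: x *: Z| <= m) -> #|T| * #|Z| <= m * #|T * Z|.
Proof.
move=> leT; rewrite mulnC [leqRHS]mulnC -[leqRHS]sum_nat_const.
have <- : \sum_(y in T * Z) #|T :&: y *: Z| = (#|Z| * #|T|)%N.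
  transitivity (\sum_(y in T * Z) \sum_(t in T) (t \in y *: Z)).
    apply: eq_bigr => y _; rewrite -sum1_card big_mkcond [RHS]big_mkcond /=.
    by apply: eq_bigr => t _; rewrite inE; case: (t \in T); case: (t \in _).
  rewrite exchange_big mulnC -sum_nat_const; apply: eq_bigr => t Tt /=.
  rewrite -(card_lcoset Z t) -sum1_card big_mkcond [RHS]big_mkcond /=.
  apply: eq_bigr => y _; rewrite lcoset_sym; case: ifP => [_|/negbT nTZ].
    by case: (y \in _).
  case: ifP => // /lcosetP[z Zz ey]; case/negP: nTZ; rewrite ey; exact: mem_mulg.
by apply: leq_sum => y _.
Qed.

Section Central.
Variables (G Z : {group gT}) (T : {set gT}) (m : nat).
Hypotheses (sZG : Z \subset G) (nZG : G \subset 'N(Z)) (sTG : T \subset G).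
Hypotheses (dTZ : [disjoint T & Z]) (leTm : forall x, #|T :&: x *: Z| <= m).

Lemma gain_step U b l :
    U \subset T -> #|subset_sums0 U * Z| = (#|Z| * b)%N ->
    m * (b * b.-1) < #|T :\: U| * (b - l) -> l <= b ->
  exists2 x, x \in T :\: U & #|Z| * (b + l).+1 <= #|subset_sums0 (x |: U) * Z|.
Proof.
move=> sUT cW ltm lb; set W := subset_sums0 U * Z in cW.
have sUG := subset_trans sUT sTG.
have WZ : W * Z = W by rewrite -mulgA mulGid.
have stZ : Z \subset lstab W by apply: sums0_mul_lstab sUG sZG nZG.
apply/exists_inP; apply: contraLR ltm => /exists_inPn noX; rewrite -leqNgt.
have leI x : x \in T :\: U -> #|Z| * (b - l) <= #|x *: W :&: W|.
  move=> TUx; have /setDP[Tx U'x] := TUx.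
  have := noX x TUx; rewrite -ltnNge => ltx.
  have := leq_ltn_trans (subset_leq_card (sums0_grow Z U'x Tx)) ltx.
  have xWZ : (x *: W) * Z = x *: W by rewrite -mulgA WZ.
  have IZ : (x *: W :&: W) * Z = x *: W :&: W.
    apply/eqP; rewrite eqEsubset mulG_subl andbT subsetI.
    have := mulSg Z (subsetIl (x *: W) W); rewrite xWZ => -> /=.
    by have := mulSg Z (subsetIr (x *: W) W); rewrite WZ.
  have /dvdnP[c ec] := rmul_dvdn IZ.
  have eqc : #|W :|: x *: W| + c * #|Z| = #|Z| * b + #|Z| * b.
    by rewrite -ec setIC cardsUI card_lcoset cW.
  move=> lt; rewrite ec [leqRHS]mulnC leq_mul2l; apply/orP; right.
  have : #|Z| * (b + b) < #|Z| * ((b + l).+1 + c).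
    by rewrite !mulnDr -eqc [(#|Z| * c)%N]mulnC ltn_add2r.
  by rewrite ltn_mul2l => /andP[_]; clia.
have dTU : [disjoint T :\: U & Z] by apply: disjointWl dTZ; apply: subsetDl.
have leTU x : #|(T :\: U) :&: x *: Z| <= m.
  by apply: leq_trans (leTm x); rewrite subset_leq_card // setSI // subsetDl.
have [b0 | b_gt0] := posnP b; first by rewrite b0 sub0n !muln0.
have := translate_average WZ stZ dTU leI; have := card_mul_multiplicity leTU.
rewrite cW -(prednK b_gt0) succnK.
move: #|T :\: U| #|(T :\: U) * Z| #|Z| b.-1 (b.-1.+1 - l)%N (cardG_gt0 Z) => t e z b' d z0 te.
move=> {}av. have {av} av : z * (e * d) <= z * (z * (b'.+1 * b')) by nia.
rewrite leq_pmul2l // in av; have : z * (t * d) <= z * (m * (b'.+1 * b')) by nia.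
by rewrite leq_pmul2l.
Qed.

(** The surplus [c] is raised to [j] while keeping [#|U| <= c + a]. Each round either finds a coset
    already in excess or adds an element gaining two cosets. The final inequality is the condition
    of [gain_step] for [l = 1] in the worst case [c = j - 1], where [b <= 2 * j.-1 + a + 1]. *)
Lemma gain_iter a j c U0 :
    U0 \subset T -> 0 < c <= j -> #|U0| <= c + a ->
    #|Z| * (#|U0| + 1 + c) <= #|subset_sums0 U0 * Z| ->
    c = j \/ m * (2 * j.-1 + a + 1) < #|T| - j.-1 - a ->
  exists2 U : {set gT}, U \subset T & #|Z| * (#|U| + 1 + j) <= #|subset_sums0 U * Z|.
Proof.
elim: {c}(j - c)%N {-2}c (erefl (j - c)%N) U0 => [|n IHn] c ec U sUT /andP[c0 cj] leU leW cond.
  by have ej : c = j by [lia]; exists U; rewrite -?ej.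
have ltcj : c < j by lia.
have {cond} ltm : m * (2 * j.-1 + a + 1) < #|T| - j.-1 - a by case: cond; clia.
have WZ : subset_sums0 U * Z * Z = subset_sums0 U * Z by rewrite -mulgA mulGid.
have /dvdnP[b eb] := rmul_dvdn WZ; rewrite mulnC in eb.
have {leW} leb : #|U| + 1 + c <= b by rewrite eb leq_pmul2l in leW.
have [ltb | ] := ltnP (#|U| + 1 + c) b.
  have leW : #|Z| * (#|U| + 1 + c.+1) <= #|subset_sums0 U * Z|.
    by rewrite eb leq_pmul2l //; clia.
  by apply: (IHn c.+1 _ U sUT _ _ leW (or_intror ltm)); clia.
move=> leb'; have {leb leb'} eqb : b = #|U| + 1 + c by apply/eqP; rewrite eqn_leq leb' leb.
have ltTU : m * (b * b.-1) < #|T :\: U| * (b - 1).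
  rewrite subn1 mulnA ltn_mul2r; apply/andP; split; first by rewrite eqb; clia.
  rewrite cardsD (setIidPr sUT); apply: leq_ltn_trans (leq_trans ltm _); last by clia.
  by rewrite leq_mul2l eqb; apply/orP; right; clia.
have b_gt0 : 0 < b by rewrite eqb; clia.
have [x /setDP[Tx U'x] leW] := gain_step sUT eb ltTU b_gt0.
have sU' : x |: U \subset T by rewrite subUset sub1set Tx.
have cU' : #|x |: U| = #|U|.+1 by rewrite cardsU1 U'x.
have {}leW : #|Z| * (#|x |: U| + 1 + c.+1) <= #|subset_sums0 (x |: U) * Z|.
  by apply: leq_trans leW; rewrite leq_mul2l cU' eqb; apply/orP; right; clia.
by apply: (IHn c.+1 _ _ sU' _ _ leW (or_intror ltm)); rewrite ?cU'; clia.
Qed.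

(** Two cosets contain at most [2 * m] elements of [T], so some [y] avoids both [x *: Z] and
    [x^-1 *: Z]. Then the cosets of [1], [x], [y] and [y * x] are distinct: a surplus of one. *)
Lemma gain_start : Z \subset 'C(T) -> 2 * m < #|T| ->
  exists U, [/\ U \subset T, #|U| = 2 & #|Z| * 4 <= #|subset_sums0 U * Z|].
Proof.
move=> cTZ lt2m.
have Z_T t : t \in T -> t \notin Z.
  by move=> Tt; apply/negP=> Zt; move/pred0P/(_ t): dTZ; rewrite /= Tt Zt.
have /card_gt0P[x Tx] : 0 < #|T| by apply: leq_ltn_trans lt2m.
have [y Ty /norP[xy x'y]] : exists2 y, y \in T & ~~ ((y \in x *: Z) || (y \in x^-1 *: Z)).
  apply/subsetPn; apply: contraL lt2m => sT; rewrite -leqNgt.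
  have -> : T = (T :&: x *: Z) :|: (T :&: x^-1 *: Z).
    apply/setP=> t; rewrite !inE -andb_orr.
    by case Tt: (t \in T) => //=; apply/esym; exact: (subsetP sT t Tt).
  have := cardsUI (T :&: x *: Z) (T :&: x^-1 *: Z).
  by have := leTm x; have := leTm x^-1; clia.
have nxy : x != y by apply: contraNneq xy => <-; apply: lcoset_refl.
exists [set x; y]; split; rewrite ?cards2 ?nxy //.
  by rewrite subUset !sub1set Tx.
pose W1 := subset_sums0 [set x] * Z.
have sW1 : Z :|: x *: Z \subset W1.
  rewrite subUset sub_sums0_mulr mulSg //; exact: sub_sums0.
have cxZ : #|Z :|: x *: Z| = (2 * #|Z|)%N.
  rewrite cardsU card_lcoset (_ : _ :&: _ = set0) ?cards0; first by clia.
  apply/setP=> t; rewrite !inE; apply/negP=> /andP[Zt].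
  by rewrite lcoset_sym mem_lcoset groupMl ?groupV // (negPf (Z_T x Tx)).
have sWU : (Z :|: x *: Z) :|: y *: (Z :|: x *: Z) \subset subset_sums0 [set x; y] * Z.
  rewrite setUC; have ny : y \notin [set x] by rewrite inE eq_sym.
  rewrite [[set x; y]]setUC; apply: subset_trans (sums0_grow Z ny Ty).
  by rewrite setUC setUSS // mulgS.
apply: leq_trans (subset_leq_card sWU).
have dis : (Z :|: x *: Z) :&: y *: (Z :|: x *: Z) = set0.
  apply/setP=> t; rewrite !(inE, mem_lcoset).
  apply/negP=> /andP[/orP[Zt | Zt] /orP[Zyt | Zyt]].
  - by move: Zyt; rewrite groupMr // groupV (negPf (Z_T y Ty)).
  - case/negP: x'y; rewrite mem_lcoset invgK.
    move: Zyt; rewrite mulgA groupMr // -groupV invMg !invgK => Zyx.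
    have e : y * x * x = x * (y * x) := centP (subsetP cTZ _ Zyx) x Tx.
    by rewrite -[x * y](mulgK x) -(mulgA x) -e mulgK.
  - case/negP: xy; rewrite mem_lcoset.
    have -> : x^-1 * y = (x^-1 * t) * (y^-1 * t)^-1.
      by rewrite invMg invgK mulgA mulgK.
    by rewrite groupMr // groupV.
  case/negP: (Z_T y Ty); rewrite -groupV.
  rewrite -(memJ_norm _ (subsetP nZG x (subsetP sTG x Tx))) conjgE.
  have -> : x^-1 * (y^-1 * x) = (x^-1 * (y^-1 * t)) * (x^-1 * t)^-1.
    by rewrite invMg invgK !mulgA mulgK.
  by rewrite groupMr // groupV.
rewrite cardsU dis cards0 card_lcoset cxZ; clia.
Qed.

Lemma gain_exists j p r :
    Z \subset 'C(T) -> odd p -> p <= r -> p * r <= #|T| + 1 + j ->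
    0 < j < p -> 1 < m <= p -> j.-1 * m.-1 + 1 < p -> (p = 3 -> j = 2 -> 5 <= r) ->
  exists2 U : {set gT}, U \subset T & #|Z| * (#|U| + 1 + j) <= #|subset_sums0 U * Z|.
Proof.
move=> cTZ oddp lepr leT /andP[j0 jp] /andP[m1 mp] jm r3.
have p3 : 2 < p by case: p oddp {lepr leT r3 mp jm} jp => [|[|[|p]]] //; case: j j0.
have ltT : 2 * m < #|T| by nia.
have [U [sUT cU leU]] := gain_start cTZ ltT.
have [j1 | j2] := leqP j 1.
  by exists U => //; rewrite cU; have -> : j = 1%N by lia.
have [ltm | gem] := ltnP (m * (2 * j.-1 + 1 + 1)) (#|T| - j.-1 - 1).
  by apply: (gain_iter (a := 1) (c := 1) sUT _ _ _ (or_intror ltm)); rewrite ?cU.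
(* The general iteration fails only for these values; for [p = 3] the last hypothesis excludes
   it. *)
have [p5 j4 m2 T20] : [/\ p = 5, j = 4, m = 2 & 20 <= #|T|].
  have {}gem : p * r <= 2 * j * m.+1 + 1.
    by move: gem; case: (j) j2 leT => // i _ leT; rewrite succnK; nia.
  have [p5 | p6] := leqP p 5; last first.
    move: jm gem; case: (j) j2 {leT jp r3} => [|[|i]] //= _; case: (m) m1 => [|[|n]] // _ /=.
    move=> jm gem; exfalso.
    have : p * p <= 6 * (i * n + i + n) + 13 by nia.
    have : i * n + i + n + 2 < p by lia.
    nia.
  have [ep | ep] : p = 3 \/ p = 5.
    by case: p oddp p3 p5 {lepr leT jp mp jm r3 gem} => [|[|[|[|[|[|p]]]]]] //; [left | right].
    move: (r3 ep); rewrite ep in gem jp jm *; move=> {}r3.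
    by have j2' : j = 2 by [lia]; rewrite j2' in gem jm r3; have := r3 erefl; lia.
  rewrite ep in gem jp jm lepr leT *.
  have j3 : 2 < j by rewrite ltnNge; apply/negP=> j2'; have ej : j = 2 by [lia]; move: gem jm; rewrite ej; lia.
  have em : m = 2 by nia.
  have ej : j = 4 by move: gem; rewrite em; lia.
  by split=> //; rewrite ej in leT; nia.
have WZ : subset_sums0 U * Z * Z = subset_sums0 U * Z by rewrite -mulgA mulGid.
have /dvdnP[b eb] := rmul_dvdn WZ; rewrite mulnC in eb.
have b4 : 4 <= b by move: leU; rewrite eb leq_pmul2l.
have [b5 | ltb] := leqP 5 b.
  apply: (gain_iter (a := 0) (c := 2) sUT); rewrite ?cU ?j4 //.
    by rewrite eb leq_pmul2l //; exact: b5.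
  by right; rewrite m2; clia.
have {b4 ltb} b4 : b = 4 by lia.
(* Here averaging gives a gain of three cosets at once, as [24 < 18 * 2]. The surplus becomes 3, and
   the iteration resumes with [a = 0]. *)
have [|| x /setDP[Tx U'x] leW] := gain_step (l := 2) sUT eb.
- by rewrite b4 m2 cardsD (setIidPr sUT) cU; clia.
- by rewrite b4.
have sU' : x |: U \subset T by rewrite subUset sub1set Tx.
have cU' : #|x |: U| = 3 by rewrite cardsU1 U'x cU.
apply: (gain_iter (a := 0) (c := 3) sU'); rewrite ?cU' ?j4 //.
  by apply: leq_trans leW; rewrite leq_mul2l b4 orbT.
by right; rewrite m2; clia.
Qed.

End Central.
End Gain.

(** * Groups of order 27 *)

Section Index.
Import GroupScope.
Variable gT : finGroupType.
Implicit Types (A B C D S T U W X Y : {set gT}) (G H K L M N Z : {group gT}) (x y g : gT).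

Lemma three_cosets N Z x y z :
    #|N : Z| = 3 -> Z \subset N -> x \in N -> y \in N -> z \in N ->
    y \notin x *: Z -> z \notin x *: Z -> z \notin y *: Z ->
  N \subset x *: Z :|: y *: Z :|: z *: Z.
Proof.
move=> iZN sZN Nx Ny Nz xy xz yz.
have disj a b : b \notin a *: Z -> a *: Z :&: b *: Z = set0.
  move=> nab; apply/setP=> t; rewrite !inE; apply/negP=> /andP[ta tb].
  by case/negP: nab; rewrite -(lcoset_eqP ta) lcoset_sym.
have sN : x *: Z :|: y *: Z :|: z *: Z \subset N.
  by rewrite !subUset !mul_subG ?sub1set.
suff /eqP-> : x *: Z :|: y *: Z :|: z *: Z == N by exact: subxx.
rewrite eqEcard sN -(Lagrange sZN) iZN !cardsU setIUl !disj // setU0 cards0 !card_lcoset.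
clia.
Qed.

(** Up to the left factor [a1 * a2], the four products are [1], [u], [v] and [u * v] with [u], [v]
    in [N] outside [Z]. These cover the quotient of order 3: either [u] and [v] differ modulo [Z],
    or [u * v] is the third class. *)
Lemma two_pairs N Z a1 b1 a2 b2 :
    Z <| N -> #|N : Z| = 3 -> a2 \in 'N(N) -> a2 \in 'N(Z) ->
    a1^-1 * b1 \in N :\: Z -> a2^-1 * b2 \in N :\: Z ->
  a1 * a2 *: N \subset [set a1; b1] * [set a2; b2] * Z.
Proof.
move=> nZ iZN nNa nZa Nu Nv; have /andP[sZN nZN] := nZ.
set v := a2^-1 * b2 in Nv; pose u := (a1^-1 * b1) ^ a2.
have {Nu} /setDP[Nu nZu] : u \in N :\: Z.
  by move: Nu; rewrite !inE !memJ_norm.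
have {Nv} /setDP[Nv nZv] := Nv.
have prod x y z : x \in [set a1; b1] -> y \in [set a2; b2] -> z \in Z ->
    x * y * z \in [set a1; b1] * [set a2; b2] * Z.
  by move=> ? ? ?; rewrite !mem_mulg.
have [A1 B1 A2 B2] : [/\ a1 \in [set a1; b1], b1 \in [set a1; b1],
    a2 \in [set a2; b2] & b2 \in [set a2; b2]] by rewrite !set21 !set22.
have eu : a1 * a2 * u = b1 * a2 by rewrite /u conjgE -!mulgA !mulKVg.
have ev : a1 * a2 * v = a1 * b2 by rewrite /v -!mulgA mulKVg.
have euv : a1 * a2 * (u * v) = b1 * b2 by rewrite mulgA eu /v -!mulgA mulKVg.
have Zin z : z \in Z -> a1 * a2 * z \in [set a1; b1] * [set a2; b2] * Z by exact: prod.
have uin z : z \in u *: Z -> a1 * a2 * z \in [set a1; b1] * [set a2; b2] * Z.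
  by case/lcosetP=> c Zc ->; rewrite mulgA eu prod.
have vin z : z \in v *: Z -> a1 * a2 * z \in [set a1; b1] * [set a2; b2] * Z.
  by case/lcosetP=> c Zc ->; rewrite mulgA ev prod.
have uvin z : z \in u * v *: Z -> a1 * a2 * z \in [set a1; b1] * [set a2; b2] * Z.
  by case/lcosetP=> c Zc ->; rewrite mulgA euv prod.
apply/subsetP=> t /lcosetP[n Nn ->] {t}.
have [vuZ | nvuZ] := boolP (v \in u *: Z); last first.
  have := @three_cosets N Z 1 u v iZN sZN (group1 N) Nu Nv.
  rewrite mul1g => /(_ nZu nZv nvuZ)/subsetP/(_ n Nn); rewrite !inE -orbA.
  by case/or3P=> [/Zin | /uin | /vin].
have := @three_cosets N Z 1 u (u * v) iZN sZN (group1 N) Nu (groupM Nu Nv).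
rewrite mul1g mem_lcoset mulKg => /(_ nZu _ nZv) cov.
have nuv : u * v \notin Z.
  apply: contra nZu => Zuv.
  have nZu : u \in 'N(Z) := subsetP nZN u Nu.
  apply: (coset_idr nZu).
  have u2 : coset Z u ^+ 2 = 1.
    rewrite -morphX //; apply: coset_id; case/lcosetP: vuZ => z Zz ev'.
    by move: Zuv; rewrite ev' mulgA groupMr // expgS expg1.
  have u3 : coset Z u ^+ 3 = 1.
    rewrite -iZN -(card_quotient nZN); apply: expg_cardG; exact: mem_quotient.
  by rewrite expgS u2 mulg1 in u3.
move: (subsetP (cov nuv) n Nn); rewrite !inE -orbA.
by case/or3P=> [/Zin | /uin | /uvin].
Qed.

(** Two disjoint pairs of partial products, each differing by an element of [N :\: Z], yield a coset
    of [N] modulo [Z]; two spare elements outside [N] then reach all cosets of [N]. The cases follow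
    the distribution of [T] over the cosets of [N]. *)
Lemma fill_index3 G N Z T :
    Z \subset 'Z(G) -> Z \proper N -> N <| G -> #|G : N| = 3 -> #|N : Z| = 3 -> #|Z| = 3 ->
    T \subset G -> [disjoint T & Z] -> (forall x, #|T :&: x *: Z| <= 2) -> 6 <= #|T| ->
  subset_sums0 T * Z = G.
Proof.
move=> sZZ pZN nNG iNG iZN cZ sTG dTZ leT2 leT.
have [sZN sNG] := (proper_sub pZN, normal_sub nNG).
have nNG' := normal_norm nNG.
have sZG := subset_trans sZZ (center_sub G).
have nZG : G \subset 'N(Z) by rewrite cents_norm // centsC (subset_trans sZZ) ?subsetIr.
have nZN : Z <| N by rewrite /normal sZN (subset_trans sNG).
have maxN : maximal N G by apply: p_index_maximal; rewrite ?iNG.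
have T_Z t : t \in T -> t \notin Z.
  by move=> Tt; apply/negP=> Zt; move/pred0P/(_ t): dTZ; rewrite /= Tt Zt.
(* Such a pair comes from one element of [T :&: N], through the products [1] and [x], or from two
   elements of [T] in one coset of [N] but not in one coset of [Z]. *)
pose unit (V : {set gT}) (a b : gT) := [/\ V \subset T, a \in G, a \in subset_sums0 V, b \in subset_sums0 V
                     & a^-1 * b \in N :\: Z].
have main V1 V2 a1 b1 a2 b2 : unit V1 a1 b1 -> unit V2 a2 b2 -> [disjoint V1 & V2] ->
    2 <= #|T :\: (V1 :|: V2) :\: N| -> subset_sums0 T * Z = G.
  move=> [sV1 Ga1 Va1 Vb1 u1] [sV2 Ga2 Va2 Vb2 u2] dV leR.
  set R := _ :\: N in leR.
  have sRT : R \subset T by apply: subset_trans (subsetDl _ _) (subsetDl _ _).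
  have fR : subset_sums0 R * N = G.
    apply: fill_index => //; last by rewrite iNG ltnS.
    by apply: setSD; apply: subset_trans (subsetDl _ _) sTG.
  have dRV : [disjoint R & V1 :|: V2].
    by rewrite -setI_eq0; apply/eqP/setP=> t; rewrite !inE; case: (t \in V1); case: (t \in V2); rewrite ?andbF.
  apply/eqP; rewrite eqEsubset sums0_mul_sub //=.
  have := two_pairs nZN iZN (subsetP nNG' a2 Ga2) (subsetP nZG a2 Ga2) u1 u2.
  have sv : [set a1; b1] * [set a2; b2] * Z \subset subset_sums0 (V1 :|: V2) * Z.
    apply: mulSg; apply: subset_trans (sums0M dV).
    by apply: mulgSS; rewrite subUset !sub1set ?Va1 ?Vb1 ?Va2 ?Vb2.
  move/subset_trans/(_ sv) => {}sv.
  have Ga : a1 * a2 \in G by rewrite groupM.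
  have <- : subset_sums0 R * (a1 * a2 *: N) = G.
    rewrite -norm_rlcoset ?(subsetP nNG') // mulgA fR; exact: rcoset_id.
  apply: subset_trans (mulgS _ sv) _; rewrite mulgA mulSg //.
  apply: subset_trans (sums0M dRV) _; apply: sums0_mono.
  by rewrite !subUset sRT sV1.
have card_T_N : #|T :&: N| <= 4.
  have le x : #|(T :&: N) :&: x *: Z| <= 2.
    by apply: leq_trans (leT2 x); rewrite subset_leq_card // setSI // subsetIl.
  have := card_mul_multiplicity le.
  have sTNZ : (T :&: N) * Z \subset N :\: Z.
    apply/subsetP=> t /mulsgP[x z /setIP[Tx Nx] Zz ->].
    by rewrite inE groupMr // T_Z // groupM // (subsetP sZN).
  move/subset_leq_card: sTNZ; rewrite cardsD (setIidPr sZN) -(Lagrange sZN) iZN cZ.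
  clia.
have cT := cardsID N T.
have unit1 x : x \in T :&: N -> unit [set x] 1 x.
  case/setIP=> Tx Nx; split; rewrite ?sub1set ?group1 ?sums0_1 //.
    by apply: (subsetP (sub_sums0 _)); rewrite set11.
  by rewrite invg1 mul1g inE Nx T_Z.
have unit2 a b : a \in T -> b \in T -> b \in a *: N -> b \notin a *: Z -> unit [set a; b] a b.
  move=> Ta Tb aNb aZb; split; rewrite ?(subsetP sTG) //.
  - by rewrite subUset !sub1set Ta.
  - by apply: (subsetP (sub_sums0 _)); rewrite set21.
  - by apply: (subsetP (sub_sums0 _)); rewrite set22.
  by rewrite inE -!mem_lcoset aZb.
have [k2 | k1] := ltnP 1 #|T :&: N|.
  have /card_gt1P[x [y [Tx Ty nxy]]] := k2.
  apply: (main _ _ _ _ _ _ (unit1 x Tx) (unit1 y Ty)).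
    by rewrite disjoints1 inE.
  have sR : T :\: N \subset T :\: ([set x] :|: [set y]) :\: N.
    apply/subsetP=> t; rewrite !inE => /andP[nNt ->]; rewrite nNt andbT /=.
    apply/norP; split; apply: contraNneq nNt => ->; [by case/setIP: Tx | by case/setIP: Ty].
  by apply: leq_trans (subset_leq_card sR); clia.
have pair_in (P : {set gT}) c : P \subset T :&: c *: N -> 3 <= #|P| ->
    exists a b, [/\ a \in P, b \in P & unit [set a; b] a b].
  move=> sP leP; have /card_gt0P[a Pa] : 0 < #|P| by clia.
  have [b Pb ab] : exists2 b, b \in P & b \notin a *: Z.
    apply/subsetPn; apply: contraL leP => sPa; rewrite -leqNgt.
    apply: leq_trans (leT2 a); rewrite subset_leq_card // subsetI sPa.
    by rewrite (subset_trans sP) ?subsetIl.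
  have /setIP[Ta ca] := subsetP sP a Pa; have /setIP[Tb cb] := subsetP sP b Pb.
  exists a, b; split=> //; apply: unit2 => //.
  by rewrite (lcoset_eqP ca).
have cardR (V1 V2 : {set gT}) : #|T :\: N| <= #|T :\: (V1 :|: V2) :\: N| + (#|V1| + #|V2|).
  have -> : T :\: (V1 :|: V2) :\: N = (T :\: N) :\: (V1 :|: V2).
    by rewrite setDDl setUC -setDDl.
  have := cardsID (V1 :|: V2) (T :\: N).
  have := subset_leq_card (subsetIr (T :\: N) (V1 :|: V2)).
  by have := (leq_card_setU V1 V2).1; clia.
have card2 (a b : gT) : #|[set a; b]| <= 2 by rewrite cards2; case: (_ != _).
have dis4 (a b a' b' : gT) : a != a' -> a != b' -> b != a' -> b != b' ->
    [disjoint [set a; b] & [set a'; b']].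
  move=> n1 n2 n3 n4; rewrite -setI_eq0; apply/eqP/setP=> y; rewrite !inE.
  apply/negP=> /andP[/orP[]/eqP-> /orP[] /eqP e]; move: n1 n2 n3 n4; rewrite e eqxx //.
(* A coset of [N] has three cosets of [Z], so two of the four elements share one of these. Each is
   paired with an element outside that coset. *)
have two_in (P : {set gT}) c : P \subset T :&: c *: N -> 4 <= #|P| -> 6 <= #|T :\: N| ->
    subset_sums0 T * Z = G.
  move=> sP leP leD.
  have [x lex] : exists x, 1 < #|P :&: x *: Z|.
    apply/existsP; apply: contraLR leP => /existsPn no; rewrite -ltnNge ltnS.
    have le1 x : #|P :&: x *: Z| <= 1 by rewrite leqNgt; exact: no.
    have := card_mul_multiplicity le1.
    have sPZ : P * Z \subset c *: N.
      apply: subset_trans (mulgSS (subset_trans sP (subsetIr _ _)) sZN) _.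
      by rewrite -mulgA mulGid.
    have := subset_leq_card sPZ; rewrite card_lcoset -(Lagrange sZN) iZN cZ.
    clia.
  have /card_gt1P[a [a' [/setIP[Pa xa] /setIP[Pa' xa'] naa']]] := lex.
  have le2 : 1 < #|P :\: x *: Z|.
    have := cardsID (x *: Z) P.
    have : #|P :&: x *: Z| <= 2.
      apply: leq_trans (leT2 x); apply: subset_leq_card; apply: setSI.
      by apply: subset_trans sP (subsetIl _ _).
    by clia.
  have /card_gt1P[b [b' [/setDP[Pb xb] /setDP[Pb' xb'] nbb']]] := le2.
  have inT t : t \in P -> t \in T by move/(subsetP sP)/setIP=> [].
  have inN s t : s \in P -> t \in P -> t \in s *: N.
    move=> /(subsetP sP)/setIP[_ cs] /(subsetP sP)/setIP[_ ct].
    by rewrite (lcoset_eqP cs).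
  have u1 : unit [set a; b] a b.
    by apply: unit2; rewrite ?inT ?inN // (lcoset_eqP xa).
  have u2 : unit [set a'; b'] a' b'.
    by apply: unit2; rewrite ?inT ?inN // (lcoset_eqP xa').
  have ne s t : s \in x *: Z -> t \notin x *: Z -> s != t.
    by move=> xs; apply: contraNneq => <-.
  apply: (main _ _ _ _ _ _ u1 u2).
    by apply: dis4 => //; [exact: ne | rewrite eq_sym ne].
  have := cardR [set a; b] [set a'; b']; have := card2 a b; have := card2 a' b'.
  by clia.
have [t Dt] : exists t, t \in T :\: N by apply/card_gt0P; clia.
have /setDP[Tt Nt] := Dt.
pose P1 := T :&: t *: N; pose P2 := T :\: N :\: t *: N.
have [s sP2] : exists s, P2 \subset T :&: s *: N.
  have [-> | /set0Pn[s]] := eqVneq P2 set0; first by exists 1; exact: sub0set.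
  rewrite !inE => /and3P[ts Ns Ts]; exists s; apply/subsetP=> y.
  rewrite !inE => /and3P[ty Ny Ty]; rewrite Ty /=.
  have := @three_cosets G N 1 t s iNG sNG (group1 G) (subsetP sTG t Tt) (subsetP sTG s Ts).
  rewrite mul1g => /(_ Nt Ns ts)/subsetP/(_ y (subsetP sTG y Ty)).
  by rewrite !inE (negPf Ny) (negPf ty).
have cD : #|T :\: N| <= #|P1| + #|P2|.
  rewrite -(cardsID (t *: N) (T :\: N)) leq_add2r subset_leq_card //.
  by apply: setSI; apply: subsetDl.
have dN a b x : x \in N -> a \notin N -> b \notin N -> [disjoint [set x] & [set a; b]].
  move=> Nx Na Nb; rewrite disjoints1 !inE; apply/norP.
  by split; [apply: contraNneq Na => <- | apply: contraNneq Nb => <-].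
have P1N a : a \in P1 -> a \notin N.
  case/setIP=> _ ta; apply: contra Nt => Na; move: ta.
  by rewrite lcoset_sym mem_lcoset groupMl ?groupV.
have P2N a : a \in P2 -> a \notin N by rewrite !inE => /and3P[].
have [k0 | /card_gt0P[x Tx]] := posnP #|T :&: N|.
  have leD : 6 <= #|T :\: N| by clia.
  have [l1 | l1] := ltnP #|P1| 3; first by apply: two_in sP2 _ leD; clia.
  have [l2 | l2] := ltnP #|P2| 3; first by apply: two_in (subxx P1) _ leD; clia.
  have [a [b [Pa Pb u1]]] := pair_in P1 t (subxx _) l1.
  have [a' [b' [Pa' Pb' u2]]] := pair_in P2 s sP2 l2.
  apply: (main _ _ _ _ _ _ u1 u2).
    have ne y z : y \in P1 -> z \in P2 -> y != z.
      by move=> /setIP[_ ty]; apply: contraTneq => <-; rewrite !inE ty.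
    by apply: dis4; exact: ne.
  have := cardR [set a; b] [set a'; b']; have := card2 a b; have := card2 a' b'.
  by clia.
have [a [b [Na Nb u2]]] : exists a b, [/\ a \notin N, b \notin N & unit [set a; b] a b].
  have [l1 | l1] := ltnP #|P1| 3; last first.
    by have [a [b [/P1N Pa /P1N Pb u1]]] := pair_in P1 t (subxx _) l1; exists a, b.
  have l2 : 3 <= #|P2| by clia.
  by have [a [b [/P2N Pa /P2N Pb u1]]] := pair_in P2 s sP2 l2; exists a, b.
apply: (main _ _ _ _ _ _ (unit1 x Tx) u2).
  by apply: dN => //; case/setIP: Tx.
have := cardR [set x] [set a; b]; have := card2 a b; rewrite cards1; clia.
Qed.

End Index.

(** * The two bounds *)

(** After at most [p + r - 2] elements are spent on two filling stages, enough remain to build a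
    full coset of the central subgroup. With [d = q - p - 1], the bound follows from
    [d * r >= d * p] and [(d - 1) * (p - 1) >= 0]. *)
Lemma two_step_budget p q r : 0 < p -> p <= r -> p + 2 <= q ->
  p * r + q + p + r <= q * r + p + 2.
Proof.
move=> p_gt0 /subnKC<- /subnKC<-; move: (_ - _) (_ - _) => a b; nia.
Qed.

Section Main.
Import GroupScope.

Lemma nilpotent_center_prime (gT : finGroupType) (G : {group gT}) q :
  nilpotent G -> prime q -> q %| #|G| -> exists2 Z : {group gT}, Z \subset 'Z(G) & #|Z| = q.
Proof.
move=> nilG prq qG; have : q \in \pi('Z(G)).
  by rewrite (pi_center_nilpotent nilG) mem_primes prq cardG_gt0.
rewrite mem_primes => /and3P[_ _ qZ].
have [x Zx ox] := Cauchy prq qZ.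
by exists <[x]>%G; rewrite ?cycle_subG.
Qed.

(** Induction on [d], dividing out a central subgroup whose order is a prime factor of [d]. *)
Lemma nilpotent_normal_of_order d (gT : finGroupType) (G : {group gT}) :
  nilpotent G -> d %| #|G| -> exists2 N : {group gT}, N <| G & #|N| = d.
Proof.
elim: {d}_.+1 {-2}d (ltnSn d) gT G => // n IHn d ltd gT G nilG dG.
have d0 : 0 < d := dvdn_gt0 (cardG_gt0 G) dG.
have [d1 | d1] := leqP d 1.
  by exists 1%G; rewrite ?normal1 // cards1; clia.
have prq := pdiv_prime d1; set q := pdiv d in prq.
have qd : q %| d := pdiv_dvd d.
have [Z sZZ cZ] := nilpotent_center_prime nilG prq (dvdn_trans qd dG).
have nZG : Z <| G := sub_center_normal sZZ.
have [||| N nNG cN] := IHn (d %/ q)%N _ _ (G / Z)%G.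
- by apply: leq_trans (ltn_Pdiv (prime_gt1 prq) d0) _.
- exact: quotient_nil.
- rewrite card_quotient ?normal_norm // -divgS ?normal_sub // cZ.
  by rewrite dvdn_divRL ?divnK // (dvdn_trans qd).
exists (coset Z @*^-1 N)%G; first by rewrite -(quotientGK nZG) cosetpre_normal.
by rewrite card_cosetpre cZ cN mulnC divnK.
Qed.

Variables (gT : finGroupType) (G : {group gT}).
Hypotheses (nilG : nilpotent G) (oddG : odd #|G|).
Let p := pdiv #|G|.

(** Modulo [H], a product of distinct elements is [x ^+ k], with [k <= p - 2] the number of factors
    from [X]. As [x] has order [p] modulo [H], the element [x ^+ p.-1] is missed. *)
Lemma sums_not_full N : #|G| = (p * N)%N -> 1 < N ->
  exists S : {set gT}, [/\ S \subset G :\ 1, #|S| + 3 = N + p & subset_sums S != G].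
Proof.
move=> eqG N1.
have G1 : 1 < #|G| by rewrite eqG; have := pdiv_gt0 #|G|; rewrite -/p; cnia.
have prp : prime p by apply: pdiv_prime.
have p2 : 2 < p.
  rewrite ltn_neqAle prime_gt1 // andbT; apply/eqP=> p2.
  by have := pdiv_dvd #|G|; rewrite -/p -p2 dvdn2 oddG.
have NG : N %| #|G| by rewrite eqG dvdn_mull.
have pN : p <= N by apply: pdiv_min_dvd.
have [H nHG cH] := nilpotent_normal_of_order nilG NG.
have [sHG nHG'] := andP nHG.
have iGH : #|G : H| = p by rewrite -divgS // cH eqG mulnK // ltnW.
have /subsetPn[x Gx nHx] : ~~ (G \subset H).
  by rewrite -indexg_gt1 iGH prime_gt1.
have [X sX cX] : exists2 X : {set gT}, X \subset x *: H & #|X| = (p - 2)%N.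
  by apply: subset_card; rewrite card_lcoset cH; clia.
have XH a : a \in X -> a \notin H.
  move=> /(subsetP sX) xa; apply: contra nHx => Ha.
  by move: xa; rewrite lcoset_sym mem_lcoset groupMl ?groupV.
have nHx' : x \in 'N(H) := subsetP nHG' x Gx.
have disHX : (H :\ 1) :&: X = set0.
  apply/setP=> a; rewrite !inE; apply/negP=> /andP[/andP[_ Ha] Xa].
  by rewrite (negPf (XH a Xa)) in Ha.
have sxH : x *: H \subset G by rewrite mul_subG ?sub1set.
exists ((H :\ 1) :|: X); split.
- rewrite subUset setSD //=; apply/subsetP=> a Xa; rewrite !inE (subsetP sxH) ?(subsetP sX) //.
  by rewrite andbT; apply: contraNneq (XH a Xa) => ->; rewrite group1.
- rewrite cardsU disHX cards0 cX; have := cardsD1 1 H; rewrite group1 cH.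
  by rewrite add1n; clia.
apply: contraTneq (groupX p.-1 Gx) => <-.
apply/negP=> /subset_sumsP[s [us sS _ eqx]].
have cosets t : {subset t <= (H :\ 1) :|: X} ->
    \prod_(a <- t) a \in 'N(H) /\
    coset H (\prod_(a <- t) a) = coset H x ^+ count (mem X) t.
  elim: t => [|a t IHt] sS'; first by rewrite big_nil group1 morph1.
  have [|nt ct] := IHt; first by move=> b tb; apply: sS'; rewrite inE tb orbT.
  have : a \in (H :\ 1) :|: X by apply: sS'; rewrite mem_head.
  rewrite big_cons in_setU => /orP[/setD1P[_ Ha] | Xa].
    have na := subsetP (normG H) a Ha.
    split; first by rewrite groupM.
    rewrite morphM //= (coset_id Ha) mul1g ct /=.
    case Xa: (a \in X) => //; first by rewrite (negPf (XH a Xa)) in Ha.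
  have Ga := subsetP sxH a (subsetP sX a Xa).
  have na := subsetP nHG' a Ga.
  split; first by rewrite groupM.
  rewrite morphM //= ct Xa expgS; congr (_ * _).
  have /lcosetP[h Hh ->] := subsetP sX a Xa.
  by rewrite morphM ?(subsetP (normG H) h Hh) //= (coset_id Hh) mulg1.
have cnt : count (mem X) s <= p - 2.
  rewrite -cX cardE -size_filter; apply: uniq_leq_size; first exact: filter_uniq.
  by move=> a; rewrite mem_filter mem_enum => /andP[].
have [_ ] := cosets s sS; rewrite -eqx morphX //.
have oX : #[coset H x] = p.
  have o1 : #[coset H x] != 1%N.
    by rewrite order_eq1; apply: contra nHx => /eqP; exact: coset_idr.
  apply/(prime_nt_dvdP prp o1).
  by rewrite -iGH -(card_quotient nHG') order_dvdG ?mem_quotient.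
move/eqP; rewrite eq_expg_mod_order oX !modn_small; first by move/eqP; clia.
  by rewrite (leq_ltn_trans cnt) // ltn_subrL; clia.
by rewrite ltn_predL; clia.
Qed.

Lemma sums0_two_steps (Z K U U2 X : {set gT}) :
    U \subset X -> U2 \subset X :\: U -> subset_sums0 U * Z = K ->
  subset_sums0 U2 * K \subset subset_sums0 (U2 :|: U) * Z.
Proof.
move=> sU sU2 <-; rewrite mulgA mulSg // sums0M //.
rewrite -setI_eq0; apply/eqP/setP=> t; rewrite !inE; apply/negP=> /andP[U2t Ut].
by have := subsetP sU2 t U2t; rewrite inE Ut.
Qed.

(** * The upper bound, for [#|G| = p * (q * r)] with [q] prime *)

Section Upper.
Variables (S : {set gT}) (q r : nat).
Hypotheses (sSG : S \subset G :\ 1) (prq : prime q) (eqG : #|G| = (p * (q * r))%N).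
Hypotheses (r1 : 1 < r) (leS : q * r + p <= #|S| + 2).

Let G1 : 1 < #|G|.
Proof. by rewrite eqG; have := pdiv_gt0 #|G|; have := prime_gt1 prq; rewrite -/p; cnia. Qed.

Let prp : prime p. Proof. exact: pdiv_prime. Qed.

Let dvd_ge d : 1 < d -> d %| #|G| -> p <= d.
Proof. by move=> ? ?; apply: pdiv_min_dvd. Qed.

Let odd_dvd d : d %| #|G| -> odd d.
Proof. by move/dvdn_odd; apply. Qed.

Let le_pr : p <= r.
Proof. by apply: dvd_ge => //; rewrite eqG !dvdn_mull. Qed.

Let q_dvd : q %| #|G|.
Proof. by rewrite eqG dvdn_mull // dvdn_mulr. Qed.

Let p3 : 2 < p.
Proof.
rewrite ltn_neqAle prime_gt1 // andbT; apply/eqP=> p2.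
by have := odd_dvd (pdiv_dvd #|G|); rewrite -/p -p2.
Qed.

Let index_Z (Z : {group gT}) : Z \subset G -> #|Z| = q -> #|G : Z| = (p * r)%N.
Proof.
move=> sZG cZ; rewrite -divgS // cZ eqG mulnCA mulKn //; exact: prime_gt0.
Qed.

Let maximal_le (M : {group gT}) : maximal M G -> #|M| <= q * r.
Proof.
move=> maxM; have sMG := proper_sub (maxgroupp maxM).
have := Lagrange sMG; have : p <= #|G : M|.
  by apply: dvd_ge; rewrite ?dvdn_indexg // indexg_gt1 proper_subn ?(maxgroupp maxM).
rewrite eqG => le e; rewrite -(leq_pmul2l (prime_gt0 prp)) -e mulnC leq_mul2l le orbT //.
Qed.

(** Distinct odd primes give [p + 2 <= q]. This slack leaves [T] with at least [#|G : Z| - 1]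
    elements, even when [S1] has [2 * q - 2]. *)
Lemma sums_full_prime_gt : p < q -> subset_sums S = G.
Proof.
move=> ltpq.
have ltpq2 : p + 2 <= q.
  have := odd_dvd q_dvd; have := odd_dvd (pdiv_dvd #|G|); rewrite -/p.
  by move: ltpq; rewrite leq_eqVlt => /orP[/eqP<- /= -> | ] //; clia.
have [Z sZZ cZ] := nilpotent_center_prime nilG prq q_dvd.
have sZG := subset_trans sZZ (center_sub G).
have nZG : Z <| G := sub_center_normal sZZ.
have iZ := index_Z sZG cZ.
have prZ : prime #|Z| by rewrite cZ.
have oddZ : odd #|Z| by rewrite cZ odd_dvd.
have sSG' := subset_trans sSG (subsetDl _ _).
have le1 : #|G : Z| + #|Z| <= #|S| + 2 by rewrite iZ cZ; apply: leq_trans leS; cnia.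
have [S1 [g [j [m [[sS1 sSZ1 sgZ cS1 jq] _]]]]] := full_coset prZ oddZ sZZ sSG le1.
set T := S :\: S1.
have sTG : T \subset G by apply: subset_trans (subsetDl _ _) sSG'.
have cT : #|T| = #|S| - #|S1| by rewrite cardsD (setIidPr sS1).
have dTZ : [disjoint T & Z].
  rewrite -setI_eq0; apply/eqP/setP=> t; rewrite !inE; apply/negP=> /andP[/andP[S1t St] Zt].
  by case/negP: S1t; apply: (subsetP sSZ1); rewrite inE St.
have pZG : Z \proper G.
  by rewrite properE sZG -indexg_gt1 iZ; cnia.
have leT : #|G : Z| <= #|T :&: G| + 1.
  rewrite (setIidPl sTG) iZ cT; move: cS1 jq; rewrite cZ => cS1 jq.
  have : p * r + 2 * q <= q * r + p + 1 by cnia.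
  by clia.
have [K [U [pZK sKG sUT eqK ltU]]] := fill_subgroup pZG (normal_norm nZG) dTZ leT.
have sTS : T \subset S := subsetDl S S1.
have sUS := subset_trans sUT sTS.
have dis (A : {set gT}) : A \subset T -> [disjoint A & S1].
  move=> sA; apply: disjointWl sA _; rewrite -setI_eq0; apply/eqP/setP=> t.
  by rewrite !inE andbC; case: (t \in S1).
have [eqKG | neKG] := eqVneq (K : {set gT}) G.
  by apply: (sums_of_coset nZG sSG' sS1 sUS (dis _ sUT) sgZ); rewrite eqK.
have pKG : K \proper G by rewrite properEneq neKG.
have sUK : U \subset K by rewrite -eqK; apply: sub_sums0_mul.
have iZ' : #|G : Z| = (pdiv #|G| * r)%N by [].
case: (fill_quotient nilG pZK pKG sSG' sUS sUK ltU iZ') => [[U2 [sU2 eqG2 ltU2]] | [M maxM leM]].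
  have sR : U2 :|: U \subset S by rewrite subUset sUS (subset_trans sU2) ?subsetDl.
  (* The second stage drew on all of [S], so [U2] may meet [S1]. That set is dropped, and a new full
     coset of [Z] is built from [S :\: R]. *)
  set R := U2 :|: U in sR.
  have sSR : S :\: R \subset G :\ 1 by apply: subset_trans (subsetDl _ _) sSG.
  have le2 : #|G : Z| + #|Z| <= #|S :\: R| + 2.
    rewrite cardsD (setIidPr sR) iZ cZ.
    have : #|R| <= #|U2| + #|U| := (leq_card_setU U2 U).1.
    have xy : (#|G : K| * #|K : Z|)%N = (p * r)%N by rewrite -iZ Lagrange_index // proper_sub.
    have lx : p <= #|K : Z|.
      apply: dvd_ge; first by rewrite indexg_gt1 proper_subn.
      by apply: dvdn_trans (dvdn_indexg _ _) (cardSg sKG).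
    have ly : p <= #|G : K|.
      by apply: dvd_ge; rewrite ?indexg_gt1 ?proper_subn ?dvdn_indexg.
    have : #|G : K| + #|K : Z| <= p + r := divisor_sum_le (pdiv_gt0 _) ly lx xy.
    have : p * r + q + p + r <= q * r + p + 2 := two_step_budget (pdiv_gt0 _) le_pr ltpq2.
    by clia.
  have [S2 [g2 [j2 [m2 [[sS2 _ sgZ2 _ _] _]]]]] := full_coset prZ oddZ sZZ sSR le2.
  apply: (sums_of_coset nZG sSG' (subset_trans sS2 (subsetDl _ _)) sR _ sgZ2).
    apply: disjointWr sS2 _; rewrite -setI_eq0; apply/eqP/setP=> t.
    by rewrite !inE; case: (t \in U2); case: (t \in U).
  apply/eqP; rewrite eqEsubset sums0_mul_sub // ?(subset_trans sR) //=.
  by rewrite -{1}eqG2 (sums0_two_steps sUS sU2 eqK).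
apply: (sums_of_maximal nilG oddG sSG eqG leS maxM).
have : 2 * r <= q * r by rewrite leq_mul2r prime_gt1 ?orbT.
have : 1 < p := prime_gt1 prp.
have := maximal_le maxM; clia.
Qed.

(** Both filling stages stay inside [T], so the first full coset of [Z] is kept throughout; the
    price is the possible deficit [j] in [#|T|]. *)
Lemma sums_full_prime_eq : q = p -> subset_sums S = G.
Proof.
move=> eqp.
have [Z sZZ cZq] := nilpotent_center_prime nilG prq q_dvd.
have sZG := subset_trans sZZ (center_sub G).
have nZG : Z <| G := sub_center_normal sZZ.
have iZ := index_Z sZG cZq.
have cZ : #|Z| = p by rewrite cZq.
have prZ : prime #|Z| by rewrite cZ.
have oddp : odd p by rewrite odd_dvd // pdiv_dvd.
have oddZ : odd #|Z| by rewrite cZ.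
have sSG' := subset_trans sSG (subsetDl _ _).
have leS' : p * r + p <= #|S| + 2 by rewrite -{1}eqp.
have le1 : #|G : Z| + #|Z| <= #|S| + 2 by rewrite iZ cZ.
have [S1 [g [j [m0 [[sS1 sSZ1 sgZ cS1 jq] [leT0 jm0]]]]]] := full_coset prZ oddZ sZZ sSG le1.
set T := S :\: S1 in leT0.
have sTS : T \subset S := subsetDl S S1.
have sTG : T \subset G by apply: subset_trans sTS sSG'.
have cT : #|T| = #|S| - #|S1| by rewrite cardsD (setIidPr sS1).
have dTZ : [disjoint T & Z].
  rewrite -setI_eq0; apply/eqP/setP=> t; rewrite !inE; apply/negP=> /andP[/andP[S1t St] Zt].
  by case/negP: S1t; apply: (subsetP sSZ1); rewrite inE St.
have leT : p * r <= #|T| + 1 + j.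
  by rewrite cT; move: cS1; rewrite cZ; have := subset_leq_card sS1; clia.
have pZG : Z \proper G.
  by rewrite properE sZG -indexg_gt1 iZ; cnia.
have dis (A : {set gT}) : A \subset T -> [disjoint A & S1].
  move=> sA; apply: disjointWl sA _; rewrite -setI_eq0; apply/eqP/setP=> t.
  by rewrite !inE andbC; case: (t \in S1).
have done_ (U : {set gT}) : U \subset T -> subset_sums0 U * Z = G -> subset_sums S = G.
  by move=> sU eqU; apply: (sums_of_coset nZG sSG' sS1 (subset_trans sU sTS) (dis _ sU) sgZ).
(* A coset of [Z] has only [p] elements, and [gain_exists] relies on [m <= p]. *)
pose m := minn m0 p.
have leTm x : #|T :&: x *: Z| <= m.
  rewrite leq_min leT0 -cZ -(card_lcoset Z x) subset_leq_card //; exact: subsetIr.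
rewrite cZ in jq jm0.
have jm : j = 0%N \/ [/\ 0 < j, 1 < m <= p & j.-1 * m.-1 + 1 < p].
  case: jm0 => [-> | [j0 m1 jm]]; [by left | right; split=> //].
    by rewrite leq_min m1 prime_gt1 // geq_minr.
  by apply: leq_ltn_trans jm; rewrite leq_add2r leq_mul2l /m; clia.
have odd_r : odd r by rewrite odd_dvd // eqG !dvdn_mull.
(* Order 27: here [#|T| >= 6] and [m <= 2], as [fill_index3] requires, and [N] is the preimage of a
   normal subgroup of order 3 of [G / Z]. *)
have [/and3P[/eqP ep /eqP er /eqP ej] | nspecial] := boolP [&& p == 3, r == 3 & j == 2].
  have [|N0 nN0 cN0] := @nilpotent_normal_of_order 3 _ (G / Z)%G (quotient_nil Z nilG).
    by rewrite card_quotient ?normal_norm // iZ er dvdn_mull.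
  pose N := (coset Z @*^-1 N0)%G.
  have nNG : N <| G by rewrite -(quotientGK nZG) cosetpre_normal.
  have sZN : Z \subset N := sub_cosetpre N0.
  have cN : #|N| = (#|Z| * 3)%N by rewrite card_cosetpre cN0.
  have iZN : #|N : Z| = 3 by rewrite -divgS // cN mulKn ?cardG_gt0.
  have iGN : #|G : N| = 3.
    by rewrite -divgS ?normal_sub // cN eqG cZ eqp ep er.
  have pZN : Z \proper N by rewrite properE sZN -indexg_gt1 iZN.
  have m2 : m <= 2 by case: jm => [|[_ _]]; rewrite ej ?ep //= => ?; clia.
  apply: (done_ T (subxx _)); apply: (fill_index3 sZZ pZN) => //; rewrite ?cZ //.
    by move=> x; apply: leq_trans (leTm x) m2.
  by move: leT; rewrite ep er ej; clia.
have r5 : p = 3 -> j = 2 -> 5 <= r.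
  move=> ep ej; have r3 : r != 3.
    by apply: contra nspecial => ->; rewrite ep ej.
  by move: odd_r r3 r1; case: (r) => [|[|[|[|[|r']]]]].
have use_max (M : {group gT}) : maximal M G -> #|T| + 2 <= #|T :&: M| + r ->
    subset_sums S = G.
  move=> maxM leM; apply: (sums_of_maximal nilG oddG sSG eqG leS maxM).
  have := maximal_le maxM; rewrite eqp => leqM.
  have : #|T :&: M| <= #|S :&: M| by rewrite subset_leq_card // setSI.
  (* This makes [S :&: M] exceed half of [M]. It is tightest for [p = 3] and [j = 2], where [5 <= r]
     is used. *)
  suff : 2 * r + 2 * j <= p * r by clia.
  have [p4 | p4] := leqP p 4; last by cnia.
  have ep : p = 3.
    by move: oddp p3 p4; case: (p) => [|[|[|[|[|n]]]]].
  have j3 : j < 3 by rewrite -ep.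
  have r3 : 3 <= r by rewrite -ep.
  rewrite ep; have [j1 | j2] := ltnP j 2; first by clia.
  have ej : j = 2 by clia.
  by have := r5 ep ej; rewrite ej; clia.
(* Either some proper [K] can be filled by its own share of [T], or no such [K] exists. In the
   latter case, a start with surplus [j] cannot stall below [G], since a stall would produce such a
   subgroup. *)
have [/existsP[K /and3P[pZK pKG leK]] | /existsPn noK] :=
  boolP [exists K : {group gT}, [&& Z \proper K, K \proper G & #|K : Z| <= #|T :&: K| + 1]].
  have nZK := subset_trans (proper_sub pKG) (normal_norm nZG).
  have [K' [U [pZK' sK'K sUT eqK' ltU]]] := fill_subgroup pZK nZK dTZ leK.
  have pK'G := sub_proper_trans sK'K pKG.
  have sUK' : U \subset K' by rewrite -eqK'; apply: sub_sums0_mul.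
  have iZ' : #|G : Z| = (pdiv #|G| * r)%N by [].
  case: (fill_quotient nilG pZK' pK'G sTG sUT sUK' ltU iZ') => [[U2 [sU2 eqG2 _]] | [M maxM leM]].
    have sR : U2 :|: U \subset T by rewrite subUset sUT (subset_trans sU2) ?subsetDl.
    apply: (done_ _ sR).
    apply/eqP; rewrite eqEsubset sums0_mul_sub // ?(subset_trans sR) //=.
    by rewrite -{1}eqG2 (sums0_two_steps sUT sU2 eqK').
  exact: use_max maxM leM.
have [U0 sU0 leU0] : exists2 U : {set gT}, U \subset T &
    #|Z| * (#|U| + 1 + j) <= #|subset_sums0 U * Z|.
  case: jm => [-> | [j0 m1 jm]].
    exists set0; rewrite ?sub0set // cards0 muln1 subset_leq_card //.
    exact: sub_sums0_mulr.
  apply: (gain_exists sZG (normal_norm nZG) sTG dTZ leTm _ oddp le_pr leT _ m1 jm r5).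
    by rewrite (subset_trans sZZ) // (subset_trans (subsetIr _ _)) // centS.
  by rewrite j0.
have leG : #|G : Z| <= #|T| + 1 + j by rewrite iZ.
case: (fill_step sZG (normal_norm nZG) sTG dTZ sU0 leU0 leG) => [[U [sUT eqU _]] | [L [pZL pLG leL]]].
  exact: done_ sUT eqU.
by have := noK L; rewrite pZL pLG /= (leq_trans leL) ?leq_addr.
Qed.

End Upper.

(** Since [N] is composite, a prime factor [q] leaves a cofactor above 1. A factor other than [p] is
    larger than [p] by minimality; if there is none, [q = p]. *)
Lemma sums_full N (S : {set gT}) :
    #|G| = (p * N)%N -> 1 < N -> ~~ prime N -> S \subset G :\ 1 -> N + p <= #|S| + 2 ->
  subset_sums S = G.
Proof.
move=> eqG N1 nprN sSG leS.
have NG : N %| #|G| by rewrite eqG dvdn_mull.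
have factor q : prime q -> q %| N -> [/\ N = (q * (N %/ q))%N & 1 < N %/ q].
  move=> prq qN; have e : N = (q * (N %/ q))%N by rewrite mulnC divnK.
  split=> //; rewrite ltnNge; apply: contra nprN => le1.
  have e1 : (N %/ q)%N = 1%N.
    by apply/eqP; rewrite eqn_leq le1 divn_gt0 ?prime_gt0 // dvdn_leq // ltnW.
  by rewrite e e1 muln1.
have [/hasP[q qN /= nqp] | /hasPn noq] := boolP (has (predC1 p) (primes N)).
  move: qN; rewrite mem_primes => /and3P[prq _ qN].
  have [eN r1] := factor _ prq qN; rewrite eN in eqG leS.
  apply: (sums_full_prime_gt sSG prq eqG r1 leS).
  rewrite ltn_neqAle eq_sym nqp /=; exact: pdiv_min_dvd (prime_gt1 prq) (dvdn_trans qN NG).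
have prq := pdiv_prime N1; have qN := pdiv_dvd N.
have [eN r1] := factor _ prq qN; rewrite eN in eqG leS.
apply: (sums_full_prime_eq sSG prq eqG r1 leS).
have := noq (pdiv N); rewrite mem_primes prq qN (ltnW N1) /= => /(_ isT).
by rewrite negbK => /eqP.
Qed.

End Main.

Theorem theorem1p2 (gT : finGroupType) (G : {group gT}) :
  nilpotent G -> odd #|G| ->
  let p := pdiv #|G| in
  1 < #|G| %/ p -> ~~ prime (#|G| %/ p) ->
  cr G = #|G| %/ p + p - 2.
Proof.
move=> nilG oddG p N1 nprN; set N := #|G| %/ p in N1 nprN *.
have eqG : #|G| = p * N by rewrite mulnC divnK // pdiv_dvd.
have [S [sSG cS neS]] := sums_not_full nilG oddG eqG N1.
rewrite -/p in cS.
rewrite /cr; case: ex_minnP => c /forallP crc minc.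
apply/eqP; rewrite eqn_leq; apply/andP; split.
  apply: minc; apply/forallP=> A; apply/implyP=> sA; apply/implyP=> leA.
  by apply/eqP; apply: (sums_full nilG oddG eqG) => //; rewrite -/p; clia.
rewrite leqNgt; apply: contra neS => ltc.
have := crc S; rewrite sSG /=; have -> // : c <= #|S| by clia.
Qed.
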